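(* \textsc{Bounded-Density Vertex Deletion} can be solved in time $2^{O(\ell^2)} n^{O(1)}$, where $n$ is the number of vertices of the input graph and $\ell$ is its vertex cover number.
   Context: All graphs are finite, simple and undirected. The density of a graph $H$ is $\rho(H)=|E(H)|/|V(H)|$ (the empty graph has density $0$), and $\rho^*(G)=\max_{H\subseteq G}\rho(H)$. \textsc{Bounded-Density Vertex Deletion}: given a graph $G$, an integer $k\ge 0$ and a rational $\tau_\rho\ge 0$, decide whether there is $S\subseteq V(G)$ with $|S|\le k$ such that $\rho^*(G-S)\le\tau_\rho$, where $G-S$ is the graph obtained by deleting the vertices in $S$. The vertex cover number of $G$ is the minimum size of a set $C\subseteq V(G)$ such that every edge has at least one endpoint in $C$. *)

(* Defs.v *)
From HB Require Import structures.
From mathcomp Require Import all_boot all_order all_algebra.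

Set Implicit Arguments.
Unset Strict Implicit.
Unset Printing Implicit Defensive.

Import Order.TTheory GRing.Theory Num.Theory.
Local Open Scope nat_scope.

(* Graphs are finite, simple and undirected: a vertex set inside an ambient
   finite type T, and a set of edges, each a 2-element set of vertices. *)
Definition graph_axiom (T : finType) (H : {set T} * {set {set T}}) : bool :=
  [forall f in H.2, (f \subset H.1) && (#|f| == 2)].

Record graph (T : finType) := Graph {
  graph_val : {set T} * {set {set T}};
  graph_valP : graph_axiom graph_val
}.

HB.instance Definition _ (T : finType) := [isSub for @graph_val T].
HB.instance Definition _ (T : finType) := [Finite of graph T by <:].

Definition vertices (T : finType) (G : graph T) : {set T} := (graph_val G).1.
Definition edges (T : finType) (G : graph T) : {set {set T}} := (graph_val G).2.

Definition subgraph (T : finType) (H G : graph T) : bool :=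
  (vertices H \subset vertices G) && (edges H \subset edges G).

(* The empty graph gets density 0, since x / 0 = 0 in rat. *)
Definition density (T : finType) (H : graph T) : rat :=
  (#|edges H|%:R / #|vertices H|%:R)%R.

(* Densities are nonnegative and the empty graph is a subgraph of G, so the
   default value 0 does not affect the maximum. *)
Definition max_density (T : finType) (G : graph T) : rat :=
  \big[Num.max/0%R]_(H : graph T | subgraph H G) density H.

Lemma delete_vertices_subproof (T : finType) (G : graph T) (S : {set T}) :
  graph_axiom (vertices G :\: S, [set f in edges G | [disjoint f & S]]).
Proof.
apply/forallP => f; apply/implyP; rewrite inE => /andP[fE fS] /=.
have /forallP/(_ f)/implyP/(_ fE)/andP[fV ->] := graph_valP G.
by rewrite andbT subsetD fV fS.
Qed.

Definition delete_vertices (T : finType) (G : graph T) (S : {set T}) : graph T :=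
  Graph (delete_vertices_subproof G S).

Definition bounded_density_vertex_deletion (T : finType) (G : graph T)
    (k : nat) (tau : rat) : bool :=
  [exists S : {set T},
    [&& S \subset vertices G, #|S| <= k
      & (max_density (delete_vertices G S) <= tau)%R]].

Definition vertex_cover (T : finType) (G : graph T) (C : {set T}) : bool :=
  (C \subset vertices G) && [forall f in edges G, ~~ [disjoint f & C]].

(* [arg min] takes a witness of the constraint: all vertices form a cover. *)
Definition vertex_cover_number (T : finType) (G : graph T) : nat :=
  #|[arg min_(C < vertices G | vertex_cover G C) #|C|]|.

(* The random access machine of Cook and Reckhow, over the natural numbers
   (with truncated subtraction). Each instruction takes one unit of time. There
   is no multiplication instruction, as this would make unit costs unrealistic;
   without it, running times agree up to a polynomial with those of Turing
   machines. *)
Inductive instr :=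
| RConst of nat & nat       (* X_i <- c *)
| RAdd of nat & nat & nat   (* X_i <- X_j + X_k *)
| RSub of nat & nat & nat   (* X_i <- X_j - X_k *)
| RLoad of nat & nat        (* X_i <- X_(X_j) *)
| RStore of nat & nat       (* X_(X_i) <- X_j *)
| RJump of nat & nat        (* continue at instruction l if X_j > 0 *)
| RRead of nat.             (* X_i <- next input number, 0 if none is left *)

Definition program := seq instr.

Record config := Config {
  pc : nat;
  regs : nat -> nat;
  input : seq nat
}.

Definition upd (m : nat -> nat) (i v : nat) : nat -> nat :=
  fun j => if j == i then v else m j.

Definition exec (ins : instr) (s : config) : config :=
  let: Config p m x := s in
  match ins with
  | RConst i c => Config p.+1 (upd m i c) x
  | RAdd i j k => Config p.+1 (upd m i (m j + m k)) x
  | RSub i j k => Config p.+1 (upd m i (m j - m k)) x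
  | RLoad i j => Config p.+1 (upd m i (m (m j))) x
  | RStore i j => Config p.+1 (upd m (m i) (m j)) x
  | RJump j l => Config (if 0 < m j then l else p.+1) m x
  | RRead i => Config p.+1 (upd m i (head 0 x)) (behead x)
  end.

(* A configuration whose program counter is outside the program is halted,
   and [step] leaves it unchanged. *)
Definition step (P : program) (s : config) : config :=
  if onth P (pc s) is Some ins then exec ins s else s.

Definition halted (P : program) (s : config) : bool := size P <= pc s.

Definition init (x : seq nat) : config := Config 0 (fun=> 0) x.

(* On input x, P halts after at most t steps with the bit b in register 0. *)
Definition outputs_within (P : program) (x : seq nat) (b : bool) (t : nat) :
    Prop :=
  let s := iter t (step P) (init x) in halted P s /\ regs s 0 = b.

(* n, k, numerator and denominator of tau in lowest terms, then the adjacency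
   matrix of G row by row. *)
Definition encode (n : nat) (G : graph 'I_n) (k : nat) (tau : rat) : seq nat :=
  [:: n; k; `|numq tau|; `|denq tau|] ++
  [seq nat_of_bool ([set i; j] \in edges G) | i <- enum 'I_n, j <- enum 'I_n].

(* Main.v *)
Require Import Defs.
From mathcomp Require Import all_boot all_order all_algebra perm zify.

Set Implicit Arguments.
Unset Strict Implicit.
Unset Printing Implicit Defensive.

Import Order.TTheory GRing.Theory Num.Theory.
Local Open Scope nat_scope.

(* Deleting a minimum vertex cover removes all edges, so only deletion sets of
   size at most l, the vertex cover number, matter. Two vertices with the same
   neighbourhood (twins) are exchanged by an automorphism, hence both a minimum
   cover and a deletion set of size at most l can be found among the vertices
   with fewer than l earlier twins. There are at most l (2^l + l) such
   vertices, as a vertex outside the cover is determined up to twins by a subset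
   of the cover, and hence 2^O(l^2) sets of at most l of them. After deleting S,
   some subgraph is too dense iff for some subset D of the cover outside S the
   set D together with all vertices outside S having more than tau neighbours
   in D is too dense, so each S is tested by trying all D.

   The algorithm is written in a language of arithmetic expressions with bounded
   recursion. Such an expression is compiled to a machine program whose running
   time is polynomial in any bound M on the lengths of the loops that are run;
   here M = (n + 1)^2 2^(4 l^2) works. *)

(** * Expressions and their compilation *)

Inductive exp :=
| Var of nat
| Const of nat
| Add of exp & exp
| Sub of exp & exp
| Inp of exp
| If of exp & exp & exp
| Fold of exp & exp & exp
| Arg of exp & exp
| Enter of exp.

(* Lists are environments of de Bruijn values. [Arg] queues an argument and
   [Enter] runs its body in the environment of the queued arguments. In the body
   of a [Fold], variable 0 is the loop index and variable 1 the accumulator. The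
   parameter [M] bounds the number of iterations of every loop that is run. *)
Inductive ev (M : nat) (x : seq nat) :
    seq nat -> seq nat -> exp -> nat -> Prop :=
| ev_var env nw j : ev M x env nw (Var j) (nth 0 env j)
| ev_const env nw c : ev M x env nw (Const c) c
| ev_add env nw e1 e2 v1 v2 :
    ev M x env [::] e1 v1 -> ev M x env [::] e2 v2 ->
    ev M x env nw (Add e1 e2) (v1 + v2)
| ev_sub env nw e1 e2 v1 v2 :
    ev M x env [::] e1 v1 -> ev M x env [::] e2 v2 ->
    ev M x env nw (Sub e1 e2) (v1 - v2)
| ev_inp env nw e v :
    ev M x env [::] e v -> ev M x env nw (Inp e) (nth 0 x v)
| ev_if_pos env nw e e1 e2 v v1 :
    ev M x env [::] e v -> 0 < v -> ev M x env [::] e1 v1 ->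
    ev M x env nw (If e e1 e2) v1
| ev_if_zero env nw e e1 e2 v2 :
    ev M x env [::] e 0 -> ev M x env [::] e2 v2 ->
    ev M x env nw (If e e1 e2) v2
| ev_fold env nw e e0 f r (F : nat -> nat) :
    ev M x env [::] e r -> r <= M -> ev M x env [::] e0 (F 0) ->
    (forall i, i < r -> ev M x [:: i, F i & env] [::] f (F i.+1)) ->
    ev M x env nw (Fold e e0 f) (F r)
| ev_arg env nw e1 e2 v1 v2 :
    ev M x env [::] e1 v1 -> ev M x env (rcons nw v1) e2 v2 ->
    ev M x env nw (Arg e1 e2) v2
| ev_enter env nw e v :
    ev M x nw [::] e v -> ev M x env nw (Enter e) v.

(* The value of [e] goes to register [t], and the registers from [t] on serve as
   scratch; [vs] and [ws] are the registers of the environment and of the queued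
   arguments, and the input is stored from address [K] on. [p] is the address of
   the code, since jumps are absolute. *)
Fixpoint compile (K p : nat) (vs ws : seq nat) (t : nat) (e : exp) :
    program :=
  match e with
  | Var j =>
      if onth vs j is Some r then [:: RConst t.+1 0; RAdd t r t.+1]
      else [:: RConst t 0]
  | Const c => [:: RConst t c]
  | Add e1 e2 =>
      let c1 := compile K p vs [::] t e1 in
      c1 ++ compile K (p + size c1) vs [::] t.+1 e2 ++ [:: RAdd t t t.+1]
  | Sub e1 e2 =>
      let c1 := compile K p vs [::] t e1 in
      c1 ++ compile K (p + size c1) vs [::] t.+1 e2 ++ [:: RSub t t t.+1]
  | Inp e1 =>
      compile K p vs [::] t e1 ++
        [:: RConst t.+1 K; RAdd t t t.+1; RLoad t t]
  | If e0 e1 e2 =>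
      let c0 := compile K p vs [::] t e0 in
      let c2 := compile K (p + size c0).+1 vs [::] t e2 in
      let q := ((p + size c0).+1 + size c2).+2 in
      let c1 := compile K q vs [::] t e1 in
      c0 ++ [:: RJump t q] ++ c2 ++
        [:: RConst t.+1 1; RJump t.+1 (q + size c1)] ++ c1
  | Fold e0 e1 f =>
      let c1 := compile K p vs [::] t e1 in
      let c0 := compile K (p + size c1) vs [::] t.+2 e0 in
      let q := (p + size c1 + size c0).+3 in
      let cf := compile K q [:: t.+1, t & vs] [::] t.+3 f in
      c1 ++ c0 ++
      [:: RConst t.+1 0; RConst t.+3 1; RJump t.+3 (q + size cf + 5)] ++
      cf ++
      [:: RConst t.+4 0; RAdd t t.+3 t.+4; RConst t.+4 1;
          RAdd t.+1 t.+1 t.+4; RSub t.+2 t.+2 t.+4; RJump t.+2 q]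
  | Arg e1 e2 =>
      let c1 := compile K p vs [::] t e1 in
      c1 ++ compile K (p + size c1) vs (rcons ws t) t.+1 e2 ++
        [:: RConst t.+2 0; RAdd t t.+1 t.+2]
  | Enter e1 => compile K p ws [::] t e1
  end.

(** Bounds how many registers from [t] on the compiled code may write to; with [t + width e <= K]
    the scratch space never reaches the stored input. *)
Fixpoint width (e : exp) : nat :=
  match e with
  | Var _ | Const _ => 2
  | Add e1 e2 | Sub e1 e2 | Arg e1 e2 => width e1 + width e2 + 3
  | Inp e1 => width e1 + 2
  | If e0 e1 e2 => width e0 + width e1 + width e2 + 2
  | Fold e0 e1 f => width e0 + width e1 + width f + 5
  | Enter e1 => width e1
  end.

(** For [Fold], the 6 counts the loop test and five bookkeeping instructions of a round, and the 4
    counts the three instructions before the loop and the last, failing test. *)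
Fixpoint time (M : nat) (e : exp) : nat :=
  match e with
  | Var _ | Const _ => 2
  | Add e1 e2 | Sub e1 e2 | Arg e1 e2 => time M e1 + time M e2 + 2
  | Inp e1 => time M e1 + 3
  | If e0 e1 e2 => time M e0 + time M e1 + time M e2 + 3
  | Fold e0 e1 f => time M e0 + time M e1 + M * (time M f + 6) + 4
  | Enter e1 => time M e1
  end.

(** * Polynomial bounds on running times *)

Definition poly_bounded (f : nat -> nat) : Prop :=
  exists c d, forall M, 0 < M -> f M <= c * M ^ d.

Lemma poly_boundedC c : poly_bounded (fun=> c).
Proof. by exists c, 0 => M _; rewrite muln1. Qed.

(** Positivity of [M] allows both powers to be raised to the common exponent [d1 + d2]. *)
Lemma poly_boundedD f g :
  poly_bounded f -> poly_bounded g -> poly_bounded (fun M => f M + g M).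
Proof.
move=> [c1 [d1 H1]] [c2 [d2 H2]]; exists (c1 + c2), (d1 + d2) => M M0.
rewrite mulnDl; apply: leq_add.
  apply: leq_trans (H1 M M0) _.
  by rewrite leq_mul2l leq_pexp2l ?leq_addr ?orbT.
apply: leq_trans (H2 M M0) _.
by rewrite leq_mul2l leq_pexp2l ?leq_addl ?orbT.
Qed.

Lemma poly_boundedM f :
  poly_bounded f -> poly_bounded (fun M => M * f M).
Proof.
move=> [c [d H]]; exists c, d.+1 => M M0.
by rewrite expnS mulnCA leq_mul2l H ?orbT.
Qed.

Lemma time_poly (e : exp) : poly_bounded (time ^~ e).
Proof.
by elim: e => //= *;
  repeat first [apply: poly_boundedC | apply: poly_boundedD
               | apply: poly_boundedM].
Qed.

(** * Bounded runs of the machine, and code placed inside a program *)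

Definition reach (P : program) (T : nat) (s s' : config) : Prop :=
  exists2 t, t <= T & iter t (step P) s = s'.

Lemma reach_refl P s : reach P 0 s s.
Proof. by exists 0. Qed.

Lemma reach_end P p p' m inp :
  p = p' -> reach P 0 (Config p m inp) (Config p' m inp).
Proof. by move=> ->; exact: reach_refl. Qed.

Lemma reach_trans P T1 T2 s1 s2 s3 :
  reach P T1 s1 s2 -> reach P T2 s2 s3 -> reach P (T1 + T2) s1 s3.
Proof.
move=> [t1 le1 <-] [t2 le2 <-]; exists (t1 + t2); first exact: leq_add.
by rewrite addnC iterD.
Qed.

Lemma reach_leq P T T' s s' : T <= T' -> reach P T s s' -> reach P T' s s'.
Proof. by move=> le [t leT <-]; exists t => //; apply: leq_trans leT le. Qed.

Definition code_at (P : program) (p : nat) (c : program) : Prop :=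
  forall i ins, onth c i = Some ins -> onth P (p + i) = Some ins.

Lemma code_at_cat P p c1 c2 :
  code_at P p (c1 ++ c2) -> code_at P p c1 /\ code_at P (p + size c1) c2.
Proof.
move=> H; split=> i ins Hi.
  apply: H; rewrite onth_cat.
  by case: ltnP => // le; move: Hi; rewrite onth_default.
rewrite -addnA; apply: H; rewrite onth_cat ltnNge leq_addr /=.
by rewrite addKn.
Qed.

Lemma code_at_cons P p ins c :
  code_at P p (ins :: c) -> onth P p = Some ins /\ code_at P p.+1 c.
Proof.
move=> H; split; first by rewrite -[p]addn0; apply: H.
by move=> i j Hi; rewrite addSnnS; apply: H.
Qed.

Lemma reach_step P T p m inp ins s :
  onth P p = Some ins -> reach P T (exec ins (Config p m inp)) s ->
  reach P T.+1 (Config p m inp) s.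
Proof.
move=> H [t le <-]; exists t.+1 => //.
by rewrite iterSr {2}/step /= H.
Qed.

Lemma updE m i v : upd m i v i = v.
Proof. by rewrite /upd eqxx. Qed.

Lemma updN m i v j : j != i -> upd m i v j = m j.
Proof. by rewrite /upd => /negPf->. Qed.

(** * Correctness of the compiler *)

Section Compiler.
Variables (M : nat) (x : seq nat) (K : nat).

(** Compiled code may disturb only the registers from [t] up to [K - 1]: those below [t] hold the
    environment and pending values, those from [K] on the input. *)
Definition frame (t : nat) (m m' : nat -> nat) : Prop :=
  forall j, (j < t) || (K <= j) -> m' j = m j.

Lemma frame_map t m m' vs :
  all (gtn t) vs -> frame t m m' -> map m' vs = map m vs.
Proof.
move=> /allP avs mm'; apply/eq_in_map => j /avs /= jt.
by apply: mm'; rewrite jt.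
Qed.

Lemma frame_trans t t' m1 m2 m3 :
  t <= t' -> frame t m1 m2 -> frame t' m2 m3 -> frame t m1 m3.
Proof. by move=> tt' f1 f2 j jt; rewrite f2 ?f1 //; lia. Qed.

Lemma frame_upd t m m' i v :
  t <= i < K -> frame t m m' -> frame t m (upd m' i v).
Proof. by move=> ti f j jt; rewrite updN ?f //; lia. Qed.

Lemma frame_input t m m' : t <= K ->
  (forall i, m (K + i) = nth 0 x i) -> frame t m m' ->
  forall i, m' (K + i) = nth 0 x i.
Proof. by move=> tK mx f i; rewrite f ?mx //; lia. Qed.

Lemma all_gtnW t t' vs : t <= t' -> all (gtn t) vs -> all (gtn t') vs.
Proof. by move=> tt'; apply: sub_all => j /= jt; apply: leq_trans jt tt'. Qed.

Lemma width_gt0 e : 1 < width e.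
Proof. by elim: e => //= *; lia. Qed.

(** Address, environment registers and scratch base are all quantified, because the code of a
    subexpression sits anywhere in a larger program and runs with a shifted scratch space. *)
Definition implements (env nw : seq nat) (e : exp) (v : nat) : Prop :=
  forall P p vs ws t m inp,
  let c := compile K p vs ws t e in
  code_at P p c -> t + width e <= K -> all (gtn t) vs -> all (gtn t) ws ->
  (forall i, m (K + i) = nth 0 x i) -> map m vs = env -> map m ws = nw ->
  exists m', [/\ reach P (time M e) (Config p m inp)
                  (Config (p + size c) m' inp),
    m' t = v & frame t m m'].

(** Common to addition and subtraction: the first value waits in register [t], which the code of the
    second operand, working from [t.+1] on, leaves intact. *)
Lemma implements_op o (g : nat -> nat -> nat) env e1 e2 v1 v2 :
  (forall i j k p m inp, exec (o i j k) (Config p m inp) =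
     Config p.+1 (upd m i (g (m j) (m k))) inp) ->
  implements env [::] e1 v1 -> implements env [::] e2 v2 ->
  forall P p vs t m inp,
  let c1 := compile K p vs [::] t e1 in
  let c := c1 ++ compile K (p + size c1) vs [::] t.+1 e2 ++
             [:: o t t t.+1] in
  code_at P p c -> t + (width e1 + width e2 + 3) <= K -> all (gtn t) vs ->
  (forall i, m (K + i) = nth 0 x i) -> map m vs = env ->
  exists m', [/\ reach P (time M e1 + time M e2 + 2) (Config p m inp)
                  (Config (p + size c) m' inp),
    m' t = g v1 v2 & frame t m m'].
Proof.
move=> oE IH1 IH2 P p vs t m inp c1 c.
move=> /code_at_cat[C1 /code_at_cat[C2 /code_at_cons[C3 _]]] wK avs mx envE.
have [||||||m1 [R1 E1 S1]] := IH1 P p vs [::] t m inp C1 => //; first by lia.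
have [||||||m2 [R2 E2 S2]] := IH2 P _ vs [::] t.+1 m1 inp C2 => //.
- by lia.
- by apply: all_gtnW avs.
- by apply: frame_input mx S1; lia.
- by rewrite (frame_map avs S1).
exists (upd m2 t (g v1 v2)); split; last first.
- by apply: frame_upd; [lia | apply: frame_trans S1 S2].
- by rewrite updE.
apply: reach_leq; last first.
  apply: reach_trans R1 _; apply: reach_trans R2 _.
  apply: reach_step C3 _; rewrite oE E2 S2 ?ltnSn // E1.
  by apply: reach_end; rewrite /c !size_cat /=; lia.
by lia.
Qed.

(** Register [t] holds the accumulator, [t.+1] the loop index and [t.+2] the number of rounds left.
    The test stands after the body and is jumped to first, so a loop of length 0 skips the body. *)
Lemma implements_fold env nw e e0 f r (F : nat -> nat) : r <= M ->
  implements env [::] e r -> implements env [::] e0 (F 0) ->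
  (forall i, i < r -> implements [:: i, F i & env] [::] f (F i.+1)) ->
  implements env nw (Fold e e0 f) (F r).
Proof.
move=> rM IHe IH0 IHf P p vs ws t m inp /=.
set c1 := compile K p vs [::] t e0.
set c0 := compile K (p + size c1) vs [::] t.+2 e.
set q := (p + size c1 + size c0).+3.
set cf := compile K q _ _ _ f.
move=> /code_at_cat[C1 /code_at_cat[C0]].
move=> /code_at_cons[D1 /code_at_cons[D2 /code_at_cons[D3]]].
move=> /code_at_cat[Cf]; rewrite -/q => /code_at_cons[E1 /code_at_cons[E2]].
move=> /code_at_cons[E3 /code_at_cons[E4 /code_at_cons[E5]]].
move=> /code_at_cons[E6 _] wK avs _ mx envE _.
have wf0 := width_gt0 f.
have [||||||m1 [R1 V1 S1]] := IH0 P p vs [::] t m inp C1 => //; first by lia.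
have [||||||m2 [R2 V2 S2]] := IHe P _ vs [::] t.+2 m1 inp C0 => //.
- by lia.
- by apply: all_gtnW avs; lia.
- by apply: frame_input mx S1; lia.
- by rewrite (frame_map avs S1).
(* Induction on the number [s] of rounds left, starting at the loop test; the index and the rounds
   left always add up to [r]. *)
have loop : forall s i m', s + i = r -> frame t m m' -> m' t = F i ->
    m' t.+1 = i -> m' t.+2 = s ->
    exists m'', [/\ reach P (s * (time M f + 6) + 1)
        (Config (q + size cf + 5) m' inp)
        (Config (q + size cf + 6) m'' inp), m'' t = F r & frame t m m''].
  elim=> [|s IHs] i m' si fr mt mt1 mt2.
    exists m'; split=> //; last by rewrite mt -si.
    apply: reach_step (_ : onth P _ = Some (RJump t.+2 q)) _.
      by rewrite -E6; congr onth; lia.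
    by rewrite /= mt2 /=; apply: reach_end; lia.
  have [|||||||m3 [R3 V3 S3]] := IHf i _ P q _ [::] t.+3 m' inp Cf => //.
  - by lia.
  - by lia.
  - by rewrite /= !ltnS leqnSn leqW //=; apply: all_gtnW avs; lia.
  - by apply: frame_input mx fr; lia.
  - by rewrite /= mt mt1 (frame_map avs fr) envE.
  pose m4 := upd (upd (upd (upd (upd m3 t.+4 0) t (F i.+1)) t.+4 1)
    t.+1 i.+1) t.+2 s.
  have fr4 : frame t m m4.
    by do 5?[apply: frame_upd; first lia]; apply: frame_trans fr S3; lia.
  have [||||m5 [R5 V5 S5]] := IHs i.+1 m4 _ fr4.
  - by lia.
  - by rewrite /m4; do 3![rewrite updN; last by lia]; rewrite updE.
  - by rewrite /m4 updN ?updE //; lia.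
  - by rewrite /m4 updE.
  exists m5; split=> //.
  apply: reach_leq; last first.
    apply: reach_step (_ : onth P _ = Some (RJump t.+2 q)) _.
      by rewrite -E6; congr onth; lia.
    rewrite /= mt2 /=; apply: reach_trans R3 _.
    apply: reach_step E1 _; apply: reach_step E2 _ => /=.
    apply: reach_step E3 _; apply: reach_step E4 _ => /=.
    apply: reach_step E5 _ => /=.
    have H1 : upd m3 t.+4 0 t.+3 + upd m3 t.+4 0 t.+4 = F i.+1.
      by rewrite updE updN ?V3 ?addn0 //; lia.
    rewrite H1 !updE.
    have -> : upd (upd (upd m3 t.+4 0) t (F i.+1)) t.+4 1 t.+1 = i.
      by rewrite !updN ?S3 ?mt1 //; lia.
    have -> : upd (upd (upd (upd m3 t.+4 0) t (F i.+1)) t.+4 1)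
        t.+1 (i + 1) t.+2 = s.+1.
      by rewrite !updN ?S3 ?mt2 //; lia.
    have -> : upd (upd (upd (upd m3 t.+4 0) t (F i.+1)) t.+4 1)
        t.+1 (i + 1) t.+4 = 1.
      by rewrite updN ?updE //; lia.
    rewrite subn1 /= addn1 -/m4.
    have -> : (q + size cf).+1.+4 = q + size cf + 5 by lia.
    exact: R5.
  by lia.
have [|||||m3 [R3 V3 S3]] :=
    loop r 0 (upd (upd m2 t.+1 0) t.+3 1); rewrite ?addn0 //.
- do 2?[apply: frame_upd; first lia].
  by apply: frame_trans S1 S2; lia.
- by rewrite !updN ?S2 ?V1 //; lia.
- by rewrite updN ?updE //; lia.
- by rewrite !updN ?V2 //; lia.
exists m3; split=> //.
apply: reach_leq; last first.
  apply: reach_trans R1 _; apply: reach_trans R2 _.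
  apply: reach_step D1 _; apply: reach_step D2 _; apply: reach_step D3 _.
  rewrite /= updE /=; apply: reach_trans R3 _; apply: reach_end.
  by rewrite !size_cat /=; rewrite -/c1 -/c0 -/q -/cf !size_cat /=; lia.
have : r * (time M f + 6) <= M * (time M f + 6) by rewrite leq_mul2r rM orbT.
by lia.
Qed.

(** The induction is on the evaluation, not on the expression, so nothing is required of branches
    that are not taken. *)
Lemma compile_correct env nw e v :
  ev M x env nw e v -> implements env nw e v.
Proof.
elim=> {env nw e v}.
- move=> env nw j P p vs ws t m inp /= C wK avs _ mx envE _.
  case jE: (onth vs j) C => [r|] /code_at_cons[C1 C2].
    case/code_at_cons: C2 => [C2 _].
    exists (upd (upd m t.+1 0) t (m r)); split; last first.
    + by do 2?[apply: frame_upd; first lia].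
    + by rewrite updE -envE (@onth_nth _ 0 (m r)) // onth_map jE.
    have rt : r < t.
      have /allP : all (gtn t) vs by [].
      by apply; apply/onthP; exists j.
    apply: reach_step C1 _; apply: reach_step C2 _ => /=.
    rewrite updE updN ?addn0; last by lia.
    by apply: reach_end; lia.
  (* A variable beyond the environment has value 0, the default of [nth] in [ev_var]. *)
  exists (upd m t 0); split; last first.
  + by apply: frame_upd; first lia.
  + rewrite updE -envE nth_default // size_map leqNgt -onthTE jE //.
  by apply: reach_leq (reach_step C1 (reach_end _ _ _ _)) => //=; lia.
- move=> env nw c P p vs ws t m inp /= /code_at_cons[C1 _] wK avs _ mx envE _.
  exists (upd m t c); split; last first.
  + by apply: frame_upd; first lia.
  + by rewrite updE.
  by apply: reach_leq (reach_step C1 (reach_end _ _ _ _)) => //=; lia.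
- move=> env nw e1 e2 v1 v2 _ IH1 _ IH2 P p vs ws t m inp /= C wK avs _ mx envE _.
  exact: (implements_op (o := RAdd) (g := addn) _ IH1 IH2).
- move=> env nw e1 e2 v1 v2 _ IH1 _ IH2 P p vs ws t m inp /= C wK avs _ mx envE _.
  exact: (implements_op (o := RSub) (g := subn) _ IH1 IH2).
- move=> env nw e v _ IH P p vs ws t m inp /=.
  move=> /code_at_cat[C0 /code_at_cons[C1 /code_at_cons[C2]]].
  move=> /code_at_cons[C3 _] wK avs _ mx envE _.
  have [||||||m1 [R1 E1 S1]] := IH P p vs [::] t m inp C0 => //; first by lia.
  have w1 := width_gt0 e.
  exists (upd (upd (upd m1 t.+1 K) t (v + K)) t (nth 0 x v)); split; last first.
  + by do 3?[apply: frame_upd; first lia].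
  + by rewrite updE.
  apply: reach_trans R1 _.
  apply: reach_step C1 _; apply: reach_step C2 _; apply: reach_step C3 _ => /=.
  have -> : upd m1 t.+1 K t + upd m1 t.+1 K t.+1 = v + K.
    by rewrite updE updN ?E1 //; lia.
  set m2 := upd (upd m1 t.+1 K) t (v + K).
  have -> : m2 (m2 t) = nth 0 x v.
    rewrite /m2 updE; do 2![rewrite updN; last by lia].
    by rewrite addnC (frame_input _ mx S1) //; lia.
  by apply: reach_end; rewrite size_cat /=; lia.
- move=> env nw e e1 e2 v v1 _ IH v0 _ IH1 P p vs ws t m inp /=.
  move=> /code_at_cat[C0 /code_at_cons[C1 /code_at_cat[_]]].
  move=> /code_at_cons[_ /code_at_cons[_ C2]] wK avs _ mx envE _.
  have [||||||m1 [R1 E1 S1]] := IH P p vs [::] t m inp C0 => //; first by lia.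
  have [||||||m2 [R2 E2 S2]] := IH1 P _ vs [::] t m1 inp C2 => //.
  + by lia.
  + by apply: frame_input mx S1; lia.
  + by rewrite (frame_map avs S1).
  exists m2; split=> //; last by apply: frame_trans S1 S2.
  apply: reach_leq; last first.
    apply: reach_trans R1 _; apply: reach_step C1 _; rewrite /= E1 v0.
    apply: reach_trans R2 _; apply: reach_end.
    by do 3!rewrite ?size_cat /=; lia.
  by lia.
- move=> env nw e e1 e2 v2 _ IH _ IH2 P p vs ws t m inp /=.
  move=> /code_at_cat[C0 /code_at_cons[C1 /code_at_cat[C2]]].
  move=> /code_at_cons[C3 /code_at_cons[C4 _]] wK avs _ mx envE _.
  have w1 := width_gt0 e.
  have [||||||m1 [R1 E1 S1]] := IH P p vs [::] t m inp C0 => //; first by lia.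
  have [||||||m2 [R2 E2 S2]] := IH2 P _ vs [::] t m1 inp C2 => //.
  + by lia.
  + by apply: frame_input mx S1; lia.
  + by rewrite (frame_map avs S1).
  exists (upd m2 t.+1 1); split=> //.
  + apply: reach_leq; last first.
      apply: reach_trans R1 _; apply: reach_step C1 _; rewrite /= E1 /=.
      apply: reach_trans R2 _; apply: reach_step C3 _; apply: reach_step C4 _.
      rewrite /= updE /=; apply: reach_end.
      by do 3!rewrite ?size_cat /=; lia.
    by lia.
  + by rewrite updN ?E2 //; lia.
  + by apply: frame_upd; [lia | apply: frame_trans S1 S2].
- move=> env nw e e0 f r F _ IHe rM _ IH0 _ IHf.
  exact: implements_fold.
- move=> env nw e1 e2 v1 v2 _ IH1 _ IH2 P p vs ws t m inp /=.
  move=> /code_at_cat[C1 /code_at_cat[C2 /code_at_cons[C3 /code_at_cons[C4 _]]]].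
  move=> wK avs aws mx envE nwE.
  have w2 := width_gt0 e2.
  have [||||||m1 [R1 E1 S1]] := IH1 P p vs [::] t m inp C1 => //; first by lia.
  have [||||||m2 [R2 E2 S2]] := IH2 P _ vs (rcons ws t) t.+1 m1 inp C2 => //.
  + by lia.
  + by apply: all_gtnW avs.
  + by rewrite all_rcons /= ltnSn; apply: all_gtnW aws.
  + by apply: frame_input mx S1; lia.
  + by rewrite (frame_map avs S1).
  + by rewrite map_rcons (frame_map aws S1) E1 nwE.
  exists (upd (upd m2 t.+2 0) t v2); split; last first.
  + by do 2?[apply: frame_upd; first lia]; apply: frame_trans S1 S2.
  + by rewrite updE.
  apply: reach_leq; last first.
    apply: reach_trans R1 _; apply: reach_trans R2 _.
    apply: reach_step C3 _; apply: reach_step C4 _ => /=.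
    rewrite updE updN ?E2 ?addn0; last by lia.
    by apply: reach_end; rewrite !size_cat /=; lia.
  by lia.
- move=> env nw e v _ IH P p vs ws t m inp /= C wK avs aws mx envE nwE.
  exact: (IH P p ws [::] t m inp C).
Qed.

End Compiler.

(** * Running an expression on the machine *)

(** A halted configuration is a fixed point of [step], so the result is still there when the full
    time bound has elapsed. *)
Lemma reach_halted P T s s' b : reach P T s s' ->
  halted P s' -> regs s' 0 = b ->
  let s'' := iter T (step P) s in halted P s'' /\ regs s'' 0 = b.
Proof.
move=> [t tT <-] h r; rewrite -(subnK tT) iterD /=.
set u := iter t _ _ in h r *.
suff -> : iter (T - t) (step P) u = u by [].
by elim: (T - t) => //= j ->; rewrite /step onth_default.
Qed.

(** The number of inputs after the first: three parameters and the matrix entries. It is computed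
    from [n], since reading past the end yields 0 and does not reveal the end. *)
Definition count_exp : exp :=
  Fold (Inp (Const 0)) (Const 3) (Add (Var 1) (Inp (Const 0))).

Lemma ev_count_exp M n : n <= M ->
  ev M [:: n] [::] [::] count_exp (3 + n * n).
Proof.
move=> nM; apply: (@ev_fold _ _ _ _ _ _ _ _ (fun i => 3 + i * n)) nM _ _ => //.
- exact: (@ev_inp _ _ _ _ _ 0 (ev_const _ _ _ _ _)).
- exact: (ev_const _ _ _ _ 3).
- move=> i _; rewrite mulSn [n + _]addnC addnA; apply: ev_add.
    exact: ev_var.
  exact: (@ev_inp _ _ _ _ _ 0 (ev_const _ _ _ _ _)).
Qed.

Definition read_loop (q : nat) : program :=
  [:: RRead 0; RAdd 1 1 3; RStore 1 0; RSub 2 2 3; RJump 2 q].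

(** As [nth] defaults to 0, the last clause also says that memory past the entries stored so far is
    blank. *)
Definition read_inv (K : nat) (x : seq nat) (i r : nat) (m : nat -> nat) :=
  [/\ m 1 = K + i, m 2 = r, m 3 = 1
    & forall j, m (K + j) = nth 0 (take i.+1 x) j].

Lemma read_loop_step P q K x r i m : code_at P q (read_loop q) ->
  3 < K -> i.+1 < size x -> read_inv K x i r.+1 m ->
  exists2 m', read_inv K x i.+1 r m' &
    reach P 5 (Config q m (drop i.+1 x))
      (Config (if 0 < r then q else q + 5) m' (drop i.+2 x)).
Proof.
move=> /code_at_cons[C1 /code_at_cons[C2 /code_at_cons[C3]]].
move=> /code_at_cons[C4 /code_at_cons[C5 _]] K3 ix [m1 m2 m3 mx].
pose v := nth 0 x i.+1.
pose m' := upd (upd (upd (upd m 0 v) 1 (K + i.+1)) (K + i.+1) v) 2 r.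
exists m'.
  split.
  - by rewrite /m'; do 2![rewrite updN; last by lia]; rewrite updE.
  - by rewrite /m' updE.
  - by rewrite /m' !updN //; lia.
  - move=> j; rewrite /m' updN; last by lia.
    rewrite (take_nth 0) // nth_rcons size_take ix /upd eqn_add2l.
    case: (ltngtP j i.+1) => ji //; last first.
      have -> : (K + j == 1) = false by lia.
      have -> : (K + j == 0) = false by lia.
      by rewrite mx nth_default // size_take ix; lia.
    have -> : (K + j == 1) = false by lia.
    have -> : (K + j == 0) = false by lia.
    by rewrite mx.
apply: reach_step C1 _ => /=; rewrite -nth0 nth_drop addn0 -/v.
have -> : behead (drop i.+1 x) = drop i.+2 x by rewrite -drop1 drop_drop add1n.
apply: reach_step C2 _ => /=; rewrite !updN // m1 m3 -addnA addn1.
apply: reach_step C3 _ => /=.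
have -> : upd (upd m 0 v) 1 (K + i.+1) 1 = K + i.+1 by rewrite updE.
have -> : upd (upd m 0 v) 1 (K + i.+1) 0 = v by rewrite updN // updE.
apply: reach_step C4 _ => /=.
have -> : upd (upd (upd m 0 v) 1 (K + i.+1)) (K + i.+1) v 2 = r.+1.
  by rewrite !updN //; lia.
have -> : upd (upd (upd m 0 v) 1 (K + i.+1)) (K + i.+1) v 3 = 1.
  by rewrite !updN //; lia.
rewrite subn1 /= -/m'; apply: reach_step C5 _ => /=.
by rewrite /m' updE; apply: reach_end; case: ifP => // _; lia.
Qed.

Lemma read_loop_correct P q K x r i m : code_at P q (read_loop q) ->
  3 < K -> i.+1 + r.+1 = size x -> read_inv K x i r.+1 m ->
  exists2 m', forall j, m' (K + j) = nth 0 x j &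
    reach P (r.+1 * 5) (Config q m (drop i.+1 x)) (Config (q + 5) m' [::]).
Proof.
move=> C K3; elim: r i m => [|r IHr] i m ir inv.
  have [|m' [_ _ _ mx] R] := read_loop_step C K3 _ inv; first by lia.
  exists m'; first by move=> j; rewrite mx take_oversize //; lia.
  by move: R; rewrite /= (@drop_oversize _ i.+2) //; lia.
have [|m1 inv1 R1] := read_loop_step C K3 _ inv; first by lia.
have [|m2 mx R2] := IHr i.+1 m1 _ inv1; first by lia.
exists m2 => //; rewrite mulSn; exact: reach_trans R1 R2.
Qed.

(** The program stores the input from address [K] on and then runs the code of [e]. It first stores
    [n] and runs [count_exp], whose result lands in register 2, the counter of the reading loop,
    while register 1 keeps the address [K]. *)
Lemma ram_of_exp (e : exp) : exists (P : program) (c d : nat),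
  forall (M n : nat) (y : seq nat) (b : nat),
    size y = 3 + n * n -> 0 < M -> n <= M ->
    ev M (n :: y) [::] [::] e b ->
    let s := iter (c * M ^ d) (step P) (init (n :: y)) in
    halted P s /\ regs s 0 = b.
Proof.
pose K := width e + width count_exp + 10.
pose c1 := compile K 3 [::] [::] 2 count_exp.
pose q := (3 + size c1).+1.
pose c2 := compile K (q + 5) [::] [::] 0 e.
pose P := [:: RRead 0; RConst 1 K; RStore 1 0] ++ c1 ++ RConst 3 1 ::
  read_loop q ++ c2.
have CP : code_at P 0 P by [].
move: (CP) => /code_at_cons[C1 /code_at_cons[C2 /code_at_cons[C3]]].
move=> /code_at_cat[C4 /code_at_cons[C5]].
move=> /(@code_at_cat _ _ (read_loop q))[C6 C7].
have [ca [da Ha]] := time_poly count_exp; have [cb [db Hb]] := time_poly e.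
(* Besides the two compiled expressions there are 4 single instructions and 5 for each of the 3 +
   n^2 numbers read, in total 19 + 5 n^2. The exponent dominates [da], [db] and the 2 coming from
   n^2 <= M^2. *)
exists P, (ca + cb + 19 + 5), (da + db + 2) => M n y b sy M0 nM He.
pose m1 := upd (upd (upd (fun=> 0) 0 n) 1 K) K n.
have w1 : 1 < width count_exp by exact: width_gt0.
have I1 := @compile_correct M [:: n] K _ _ _ _ (ev_count_exp nM).
have [||||||m2 [R2 E2 S2]] := I1 P 3 [::] [::] 2 m1 y C4 => //.
- by rewrite /K; lia.
- case=> [|i]; first by rewrite addn0 /m1 updE.
  by rewrite /m1 /= nth_nil !updN // /K; lia.
have m2K j : m2 (K + j) = nth 0 [:: n] j.
  rewrite S2; last by lia.
  case: j => [|j]; first by rewrite addn0 /m1 updE.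
  by rewrite /m1 /= nth_nil !updN // /K; lia.
have K3 : 3 < K by rewrite /K; lia.
have [||||m3 mx R3] :=
    @read_loop_correct P q K (n :: y) (2 + n * n) 0 (upd m2 3 1) => //.
- by rewrite /=; lia.
- split; rewrite ?updE //.
  + rewrite updN // S2 // addn0 /m1 updN ?updE //; lia.
  + by move=> j; rewrite updN ?m2K /= ?take0 //; lia.
have I2 := @compile_correct M _ K _ _ _ _ He.
have [||||||m4 [R4 E4 _]] := I2 P (q + 5) [::] [::] 0 m3 [::] C7 => //.
  by rewrite /K; lia.
have Pend : size P = q + 5 + size c2.
  have qE : q = (3 + size c1).+1 by [].
  by rewrite /P; do 3!rewrite ?size_cat /=.
apply: (@reach_halted _ _ _ (Config (q + 5 + size c2) m4 [::])) => //; last first.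
  by rewrite /halted Pend.
apply: reach_leq; last first.
  apply: reach_step C1 _; apply: reach_step C2 _; apply: reach_step C3 _ => /=.
  rewrite updE (_ : upd (upd (fun=> 0) 0 n) 1 K 0 = n) // -/m1.
  apply: reach_trans R2 _; apply: reach_step C5 _ => /=.
  rewrite /= drop0 in R3.
  apply: reach_trans R3 _; exact: R4.
have := Ha M M0; have := Hb M M0.
have nn : n * n <= M ^ 2 by rewrite -mulnn leq_mul.
have D d : d <= da + db + 2 -> M ^ d <= M ^ (da + db + 2).
  by move=> ?; rewrite leq_pexp2l.
have := D da ltac:(lia); have := D db ltac:(lia); have := D 2 ltac:(lia).
have : 0 < M ^ (da + db + 2) by rewrite expn_gt0 M0.
move: (M ^ (da + db + 2)) => X X0 h2 hb ha tb ta.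
have : ca * M ^ da <= ca * X by rewrite leq_mul2l ha orbT.
have : cb * M ^ db <= cb * X by rewrite leq_mul2l hb orbT.
by rewrite !mulnDl; lia.
Qed.

(** * The algorithm *)

Definition Pos e := If e (Const 1) (Const 0).
Definition Not e := Sub (Const 1) e.
Definition Lt e1 e2 := Pos (Sub e2 e1).
Definition Le e1 e2 := Not (Lt e2 e1).
Definition And e1 e2 := If e1 e2 (Const 0).
Definition Or e1 e2 := If e1 (Const 1) e2.
Definition Eq e1 e2 := And (Le e1 e2) (Le e2 e1).
Definition Sum e f := Fold e (Const 0) (Add (Var 1) f).
Definition Ex e f := Pos (Sum e f).
Definition All e f := Not (Ex e (Not f)).

(** Arguments are evaluated in the environment of the caller, whereas the body sees only the
    arguments, numbered from 0; each loop inside the body shifts these indices by 2. *)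
Definition Call1 f e1 := Arg e1 (Enter f).
Definition Call2 f e1 e2 := Arg e1 (Arg e2 (Enter f)).
Definition Call3 f e1 e2 e3 := Arg e1 (Arg e2 (Arg e3 (Enter f))).
Definition Call4 f e1 e2 e3 e4 :=
  Arg e1 (Arg e2 (Arg e3 (Arg e4 (Enter f)))).

Definition Mul := Call2 (Sum (Var 0) (Var 3)).
Definition Pow := Call2 (Fold (Var 1) (Const 1) (Mul (Var 2) (Var 1))).
(** The quotient is the number of positive multiples of the divisor that do not exceed the
    dividend. *)
Definition Div :=
  Call2 (Sum (Var 0) (Le (Mul (Add (Const 1) (Var 0)) (Var 3)) (Var 2))).
Definition Mod :=
  Call2 (Sub (Var 0) (Mul (Div (Var 0) (Var 1)) (Var 1))).
Definition Digit := Call3 (Mod (Div (Var 1) (Pow (Var 0) (Var 2))) (Var 0)).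

Definition NumVertices := Inp (Const 0).
Definition Budget := Inp (Const 1).
Definition TauNum := Inp (Const 2).
Definition TauDen := Inp (Const 3).
Definition Adj :=
  Call2 (Inp (Add (Const 4) (Add (Mul (Var 0) NumVertices) (Var 1)))).
Definition Twin :=
  Call2 (All NumVertices (Eq (Adj (Var 2) (Var 0)) (Adj (Var 3) (Var 0)))).
Definition Cand := Call2 (Lt (Sum (Var 1) (Twin (Var 0) (Var 3))) (Var 0)).
Definition Rank := Call2 (Sum (Var 1) (Cand (Var 2) (Var 0))).
Definition Base := Call1 (Add (Const 1) (Rank (Var 0) NumVertices)).
Definition Codes := Call1 (Pow (Base (Var 0)) (Var 0)).
Definition Memb :=
  Call3 (And (Cand (Var 0) (Var 2))
    (Ex (Var 0) (Eq (Digit (Base (Var 2)) (Var 3) (Var 0))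
                    (Add (Const 1) (Rank (Var 2) (Var 4)))))).
Definition Cover :=
  Call2 (All NumVertices (All NumVertices (Or (Not (Adj (Var 2) (Var 0)))
    (Or (Memb (Var 4) (Var 5) (Var 2)) (Memb (Var 4) (Var 5) (Var 0)))))).
Definition Found := Call1 (Ex (Codes (Var 0)) (Cover (Var 2) (Var 0))).
(* The fold stores the successor of the least size found, and 0 before. *)
Definition Ell :=
  Sub (Fold (Add (Const 1) NumVertices) (Const 0)
    (If (Var 1) (Var 1)
        (If (Found (Var 0)) (Add (Const 1) (Var 0)) (Const 0))))
    (Const 1).
Definition Deg :=
  Call4 (Sum NumVertices (And (Adj (Var 5) (Var 0))
    (And (Memb (Var 2) (Var 4) (Var 0)) (Not (Memb (Var 2) (Var 3) (Var 0)))))).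
Definition Dense :=
  Call4 (And (Not (Memb (Var 0) (Var 1) (Var 3)))
    (Or (Memb (Var 0) (Var 2) (Var 3))
        (Lt TauNum (Mul (Deg (Var 0) (Var 1) (Var 2) (Var 3)) TauDen)))).
Definition DenseCard :=
  Call3 (Sum NumVertices (Dense (Var 2) (Var 3) (Var 4) (Var 0))).
Definition DenseArcs :=
  Call3 (Sum NumVertices (Sum NumVertices (And (Adj (Var 2) (Var 0))
    (And (Dense (Var 4) (Var 5) (Var 6) (Var 2))
         (Dense (Var 4) (Var 5) (Var 6) (Var 0)))))).
Definition Viol :=
  Call3 (Lt (Mul (Add (DenseCard (Var 0) (Var 1) (Var 2))
                      (DenseCard (Var 0) (Var 1) (Var 2))) TauNum)
            (Mul (DenseArcs (Var 0) (Var 1) (Var 2)) TauDen)).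
Definition Good :=
  Call2 (And (Le (Sum NumVertices (Memb (Var 2) (Var 3) (Var 0))) Budget)
             (All (Codes (Var 0)) (Not (Viol (Var 2) (Var 3) (Var 0))))).
Definition Solve :=
  Call1 (Ex (Codes (Var 0)) (Good (Var 2) (Var 0))) Ell.

(** * Values of the expressions and bounds on their loops *)

Section Values.
Variables (n k p q : nat) (A : nat -> nat -> bool).

(** These are open neighbourhoods: for the adjacency of a simple graph, twins are never adjacent. *)
Definition twin i j := all (fun w => (A i w : nat) == A j w) (iota 0 n).
Definition cand m v := \sum_(0 <= w < v) twin w v < m.
Definition rank m v := \sum_(0 <= w < v) cand m w.
Definition base m := 1 + rank m n.
Definition codes m := base m ^ m.
Definition digit b x j := (x %/ b ^ j) %% b.
(* A code lists at most [m] candidates as digits in base [base m]: digit 0 stands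
   for no vertex and a positive digit for the candidate of the preceding rank. *)
Definition memb m x v := cand m v &&
  has (fun j => digit (base m) x j == 1 + rank m v) (iota 0 m).
Definition coverb m x := all (fun i => all (fun j =>
  ~~ A i j || (memb m x i || memb m x j)) (iota 0 n)) (iota 0 n).
Definition found m := has (coverb m) (iota 0 (codes m)).
(** Here and below [x] codes the deletion set and [y] the guessed trace of a dense set, and [p / q]
    is the density bound. *)
Definition deg m x y v :=
  \sum_(0 <= w < n) (A v w && (memb m y w && ~~ memb m x w)).
Definition dense m x y v :=
  ~~ memb m x v && (memb m y v || (p < deg m x y v * q)).
Definition dense_card m x y := \sum_(0 <= v < n) dense m x y v.
Definition dense_arcs m x y := \sum_(0 <= i < n) \sum_(0 <= j < n)
  (A i j && (dense m x y i && dense m x y j)).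
(* Arcs count every edge twice, hence the doubled cardinal. *)
Definition viol m x y :=
  (dense_card m x y + dense_card m x y) * p < dense_arcs m x y * q.
Definition good m x := (\sum_(0 <= v < n) memb m x v <= k) &&
  all (fun y => ~~ viol m x y) (iota 0 (codes m)).
Definition solve m := has (good m) (iota 0 (codes m)).

Lemma sum_bool_leq (P : nat -> bool) r : \sum_(0 <= i < r) P i <= r.
Proof.
rewrite big_mkord -[X in _ <= X]card_ord -sum1_card.
by apply: leq_sum => i _; case: (P i).
Qed.

Lemma rank_leq m v : rank m v <= v.
Proof. exact: sum_bool_leq. Qed.

Variables (M : nat) (x : seq nat).
(** [nM] leaves room for loops over vertices or sizes, and for products whose first factor is a
    number of arcs or twice a number of vertices. Loops governed by the number of codes are bounded
    separately. *)
Hypotheses (x0 : nth 0 x 0 = n) (x1 : nth 0 x 1 = k) (x2 : nth 0 x 2 = p)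
  (x3 : nth 0 x 3 = q)
  (xA : forall i j, i < n -> j < n -> nth 0 x (4 + (i * n + j)) = A i j)
  (nM : n * n + n + n + 1 <= M).

Local Notation "E |- e ~> v" := (ev M x E [::] e v)
  (at level 70, e at level 40, v at level 40).

Lemma ev_pos E e v : E |- e ~> v -> E |- Pos e ~> (0 < v).
Proof.
case: v => [|v] H; first by apply: ev_if_zero H (ev_const _ _ _ _ _).
by apply: ev_if_pos H _ (ev_const _ _ _ _ _).
Qed.

Lemma ev_not E e (b : bool) : E |- e ~> b -> E |- Not e ~> (~~ b).
Proof.
move=> H; have -> : nat_of_bool (~~ b) = 1 - b by case: b {H}.
exact: ev_sub (ev_const _ _ _ _ _) H.
Qed.

Lemma ev_lt E e1 e2 v1 v2 : E |- e1 ~> v1 -> E |- e2 ~> v2 ->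
  E |- Lt e1 e2 ~> (v1 < v2).
Proof. by move=> H1 H2; rewrite -subn_gt0; apply/ev_pos/ev_sub. Qed.

Lemma ev_le E e1 e2 v1 v2 : E |- e1 ~> v1 -> E |- e2 ~> v2 ->
  E |- Le e1 e2 ~> (v1 <= v2).
Proof. by move=> H1 H2; rewrite leqNgt; apply/ev_not/ev_lt. Qed.

Lemma ev_and E e1 e2 (b1 b2 : bool) : E |- e1 ~> b1 ->
  (b1 -> E |- e2 ~> b2) -> E |- And e1 e2 ~> (b1 && b2).
Proof.
case: b1 => H1 H2; first by apply: ev_if_pos H1 _ (H2 _).
exact: ev_if_zero H1 (ev_const _ _ _ _ _).
Qed.

Lemma ev_or E e1 e2 (b1 b2 : bool) : E |- e1 ~> b1 ->
  (~~ b1 -> E |- e2 ~> b2) -> E |- Or e1 e2 ~> (b1 || b2).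
Proof.
case: b1 => H1 H2; first by apply: ev_if_pos H1 _ (ev_const _ _ _ _ _).
by apply: ev_if_zero H1 (H2 _).
Qed.

Lemma ev_eq E e1 e2 v1 v2 : E |- e1 ~> v1 -> E |- e2 ~> v2 ->
  E |- Eq e1 e2 ~> (v1 == v2).
Proof.
move=> H1 H2; rewrite eqn_leq.
by apply: ev_and => [|_]; apply: ev_le.
Qed.

Lemma ev_sum E e f r (F : nat -> nat) : E |- e ~> r -> r <= M ->
  (forall i a, i < r -> [:: i, a & E] |- f ~> (F i)) ->
  E |- Sum e f ~> (\sum_(0 <= i < r) F i).
Proof.
move=> He rM Hf; apply: (@ev_fold _ _ _ _ _ _ _ _
  (fun r => \sum_(0 <= i < r) F i)) He rM _ _.
  by rewrite big_geq //; apply: ev_const.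
move=> i ir; rewrite big_nat_recr //=; apply: ev_add (Hf _ _ ir).
exact: ev_var.
Qed.

Lemma ev_ex E e f r (P : nat -> bool) : E |- e ~> r -> r <= M ->
  (forall i a, i < r -> [:: i, a & E] |- f ~> (P i)) ->
  E |- Ex e f ~> (has P (iota 0 r)).
Proof.
move=> He rM Hf; have -> : has P (iota 0 r) = (0 < \sum_(0 <= i < r) P i).
  rewrite has_count -sum1_count big_mkcond /= /index_iota subn0.
  by congr (_ < _); apply: eq_bigr => i _; case: (P i).
by apply/ev_pos/ev_sum.
Qed.

Lemma ev_all E e f r (P : nat -> bool) : E |- e ~> r -> r <= M ->
  (forall i a, i < r -> [:: i, a & E] |- f ~> (P i)) ->
  E |- All e f ~> (all P (iota 0 r)).
Proof.
move=> He rM Hf.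
have -> : all P (iota 0 r) = ~~ has (fun i => ~~ P i) (iota 0 r).
  by rewrite -all_predC; apply: eq_all => i /=; rewrite negbK.
by apply/ev_not/ev_ex => // i a ir; apply/ev_not/Hf.
Qed.

Lemma ev_call1 E f e1 v1 v : E |- e1 ~> v1 ->
  [:: v1] |- f ~> v -> E |- Call1 f e1 ~> v.
Proof. by move=> H1 H; apply: ev_arg H1 _; apply: ev_enter. Qed.

Lemma ev_call2 E f e1 e2 v1 v2 v : E |- e1 ~> v1 -> E |- e2 ~> v2 ->
  [:: v1; v2] |- f ~> v -> E |- Call2 f e1 e2 ~> v.
Proof.
by move=> H1 H2 H; apply: ev_arg H1 _; apply: ev_arg H2 _; apply: ev_enter.
Qed.

Lemma ev_call3 E f e1 e2 e3 v1 v2 v3 v :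
  E |- e1 ~> v1 -> E |- e2 ~> v2 -> E |- e3 ~> v3 ->
  [:: v1; v2; v3] |- f ~> v -> E |- Call3 f e1 e2 e3 ~> v.
Proof.
move=> H1 H2 H3 H; apply: ev_arg H1 _; apply: ev_arg H2 _.
by apply: ev_arg H3 _; apply: ev_enter.
Qed.

Lemma ev_call4 E f e1 e2 e3 e4 v1 v2 v3 v4 v :
  E |- e1 ~> v1 -> E |- e2 ~> v2 -> E |- e3 ~> v3 -> E |- e4 ~> v4 ->
  [:: v1; v2; v3; v4] |- f ~> v -> E |- Call4 f e1 e2 e3 e4 ~> v.
Proof.
move=> H1 H2 H3 H4 H; apply: ev_arg H1 _; apply: ev_arg H2 _.
by apply: ev_arg H3 _; apply: ev_arg H4 _; apply: ev_enter.
Qed.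

Lemma ev_mul E e1 e2 v1 v2 : E |- e1 ~> v1 -> E |- e2 ~> v2 -> v1 <= M ->
  E |- Mul e1 e2 ~> (v1 * v2).
Proof.
move=> H1 H2 le; apply: ev_call2 H1 H2 _.
have -> : v1 * v2 = \sum_(0 <= i < v1) v2 by rewrite sum_nat_const_nat subn0.
apply: ev_sum le _; first exact: ev_var.
by move=> i a _; apply: ev_var.
Qed.

(** The multiplication loops over its first factor, the fixed base, so the accumulated power itself
    may exceed [M]. *)
Lemma ev_pow E e1 e2 v1 v2 : E |- e1 ~> v1 -> E |- e2 ~> v2 ->
  v1 <= M -> v2 <= M -> E |- Pow e1 e2 ~> (v1 ^ v2).
Proof.
move=> H1 H2 le1 le2; apply: ev_call2 H1 H2 _.
apply: (@ev_fold _ _ _ _ _ _ _ _ (expn v1)) le2 _ _.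
- exact: ev_var.
- exact: ev_const.
- by move=> i _; rewrite expnS; apply: ev_mul => //; apply: ev_var.
Qed.

(** All loops have length at most [v1], so the divisor, in [Digit] a power of the base, may exceed
    [M]. *)
Lemma ev_div E e1 e2 v1 v2 : E |- e1 ~> v1 -> E |- e2 ~> v2 ->
  v1 <= M -> 0 < v2 -> E |- Div e1 e2 ~> (v1 %/ v2).
Proof.
move=> H1 H2 le v0; apply: ev_call2 H1 H2 _.
have -> : v1 %/ v2 = \sum_(0 <= i < v1) ((1 + i) * v2 <= v1).
  have dv : v1 %/ v2 <= v1 by exact: leq_div.
  rewrite (@big_cat_nat _ _ _ (v1 %/ v2)) //= [X in _ + X]big_nat_cond.
  rewrite [X in _ + X]big1 ?addn0 => [|i]; last first.
    by rewrite andbT => /andP[i1 _]; rewrite -leq_divRL // ltnNge i1.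
  rewrite big_nat_cond (eq_bigr (fun=> 1)) => [|i]; last first.
    by rewrite andbT => /andP[_ i1]; rewrite -leq_divRL // i1.
  by rewrite -big_nat_cond sum_nat_const_nat subn0 muln1.
apply: ev_sum (le) _; first exact: ev_var.
move=> i a iv; apply: ev_le; last exact: ev_var.
apply: ev_mul; [|exact: ev_var|by lia].
by apply: ev_add; [exact: ev_const | exact: ev_var].
Qed.

Lemma ev_mod E e1 e2 v1 v2 : E |- e1 ~> v1 -> E |- e2 ~> v2 ->
  v1 <= M -> 0 < v2 -> E |- Mod e1 e2 ~> (v1 %% v2).
Proof.
move=> H1 H2 le v0; apply: ev_call2 H1 H2 _.
have -> : v1 %% v2 = v1 - v1 %/ v2 * v2 by rewrite {2}(divn_eq v1 v2) addKn.
apply: ev_sub; first exact: ev_var.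
apply: ev_mul; [|exact: ev_var|exact: leq_trans (leq_div _ _) le].
by apply: ev_div => //; exact: ev_var.
Qed.

Lemma ev_digit E e1 e2 e3 b y j : E |- e1 ~> b -> E |- e2 ~> y ->
  E |- e3 ~> j -> 0 < b -> b <= M -> y <= M -> j <= M ->
  E |- Digit e1 e2 e3 ~> (digit b y j).
Proof.
move=> H1 H2 H3 b0 bM yM jM; apply: ev_call3 H1 H2 H3 _.
apply: ev_mod => //; [|exact: ev_var|exact: leq_trans (leq_div _ _) yM].
apply: ev_div => //; [exact: ev_var| |by rewrite expn_gt0 b0].
by apply: ev_pow => //; exact: ev_var.
Qed.

Lemma ev_input E c v : nth 0 x c = v -> E |- Inp (Const c) ~> v.
Proof. by move=> <-; apply: ev_inp; exact: ev_const. Qed.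

Lemma ev_order E : E |- NumVertices ~> n. Proof. exact: ev_input. Qed.
Lemma ev_budget E : E |- Budget ~> k. Proof. exact: ev_input. Qed.
Lemma ev_num E : E |- TauNum ~> p. Proof. exact: ev_input. Qed.
Lemma ev_den E : E |- TauDen ~> q. Proof. exact: ev_input. Qed.

Lemma ev_adj E e1 e2 i j : E |- e1 ~> i -> E |- e2 ~> j -> i < n -> j < n ->
  E |- Adj e1 e2 ~> (A i j).
Proof.
move=> H1 H2 ni nj; apply: ev_call2 H1 H2 _.
rewrite -xA //; apply: ev_inp; apply: ev_add; first exact: ev_const.
apply: ev_add; last exact: ev_var.
by apply: ev_mul; [exact: ev_var|exact: ev_order|lia].
Qed.

Lemma ev_twin E e1 e2 i j : E |- e1 ~> i -> E |- e2 ~> j -> i < n -> j < n ->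
  E |- Twin e1 e2 ~> (twin i j).
Proof.
move=> H1 H2 ni nj; apply: ev_call2 H1 H2 _.
apply: ev_all; [exact: ev_order|by lia|move=> w a wn].
by apply: ev_eq; apply: ev_adj => //; exact: ev_var.
Qed.

Lemma ev_cand E e1 e2 m v : E |- e1 ~> m -> E |- e2 ~> v -> v < n ->
  E |- Cand e1 e2 ~> (cand m v).
Proof.
move=> H1 H2 vn; apply: ev_call2 H1 H2 _.
apply: ev_lt; last exact: ev_var.
apply: ev_sum; [exact: ev_var|by lia|move=> w a wn].
by apply: ev_twin => //; [exact: ev_var|exact: ev_var|lia].
Qed.

Lemma ev_rank E e1 e2 m v : E |- e1 ~> m -> E |- e2 ~> v -> v <= n ->
  E |- Rank e1 e2 ~> (rank m v).
Proof.
move=> H1 H2 vn; apply: ev_call2 H1 H2 _.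
apply: ev_sum; [exact: ev_var|by lia|move=> w a wn].
by apply: ev_cand => //; [exact: ev_var|exact: ev_var|lia].
Qed.

Lemma ev_base E e1 m : E |- e1 ~> m -> E |- Base e1 ~> (base m).
Proof.
move=> H1; apply: ev_call1 H1 _; apply: ev_add; first exact: ev_const.
by apply: ev_rank => //; [exact: ev_var|exact: ev_order].
Qed.

Lemma base_leq m : base m <= M.
Proof. by have := rank_leq m n; rewrite /base; lia. Qed.

Lemma ev_codes E e1 m : E |- e1 ~> m -> m <= n -> E |- Codes e1 ~> (codes m).
Proof.
move=> H1 mn; apply: ev_call1 H1 _; apply: ev_pow; last by lia.
- by apply: ev_base; exact: ev_var.
- exact: ev_var.
- exact: base_leq.
Qed.

Section FixedSize.
Variable m : nat.
Hypotheses (mn : m <= n) (mM : codes m <= M).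

Lemma ev_memb E e1 e2 e3 y v : E |- e1 ~> m -> E |- e2 ~> y -> E |- e3 ~> v ->
  y < codes m -> v < n -> E |- Memb e1 e2 e3 ~> (memb m y v).
Proof.
move=> H1 H2 H3 yc vn; apply: ev_call3 H1 H2 H3 _.
apply: ev_and => [|_]; first by apply: ev_cand; [exact: ev_var|exact: ev_var|].
apply: ev_ex; [exact: ev_var|by lia|move=> j a jm].
apply: ev_eq.
  apply: ev_digit => //; try lia; try exact: ev_var; last exact: base_leq.
  by apply: ev_base; exact: ev_var.
apply: ev_add; first exact: ev_const.
by apply: ev_rank; [exact: ev_var|exact: ev_var|lia].
Qed.

Lemma ev_cover E e1 e2 y : E |- e1 ~> m -> E |- e2 ~> y -> y < codes m ->
  E |- Cover e1 e2 ~> (coverb m y).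
Proof.
move=> H1 H2 yc; apply: ev_call2 H1 H2 _.
apply: ev_all; [exact: ev_order|by lia|move=> i a1 ni].
apply: ev_all; [exact: ev_order|by lia|move=> j a2 nj].
apply: ev_or => [|_].
  by apply/ev_not/ev_adj => //; exact: ev_var.
by apply: ev_or => [|_]; apply: ev_memb => //; exact: ev_var.
Qed.

Lemma ev_found E e1 : E |- e1 ~> m -> E |- Found e1 ~> (found m).
Proof.
move=> H1; apply: ev_call1 H1 _; apply: ev_ex => //.
  by apply: ev_codes => //; exact: ev_var.
by move=> y a yc; apply: ev_cover => //; exact: ev_var.
Qed.

Section Pair.
Variables y z : nat.
Hypotheses (yc : y < codes m) (zc : z < codes m).

Lemma ev_deg E e1 e2 e3 e4 v : E |- e1 ~> m -> E |- e2 ~> y -> E |- e3 ~> z ->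
  E |- e4 ~> v -> v < n -> E |- Deg e1 e2 e3 e4 ~> (deg m y z v).
Proof.
move=> H1 H2 H3 H4 vn; apply: ev_call4 H1 H2 H3 H4 _.
apply: ev_sum; [exact: ev_order|by lia|move=> w a wn].
apply: ev_and => [|_]; first by apply: ev_adj => //; exact: ev_var.
apply: ev_and => [|_]; first by apply: ev_memb => //; exact: ev_var.
by apply/ev_not/ev_memb => //; exact: ev_var.
Qed.

Lemma ev_dense E e1 e2 e3 e4 v : E |- e1 ~> m -> E |- e2 ~> y ->
  E |- e3 ~> z -> E |- e4 ~> v -> v < n ->
  E |- Dense e1 e2 e3 e4 ~> (dense m y z v).
Proof.
move=> H1 H2 H3 H4 vn; apply: ev_call4 H1 H2 H3 H4 _.
apply: ev_and => [|_]; first by apply/ev_not/ev_memb => //; exact: ev_var.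
apply: ev_or => [|_]; first by apply: ev_memb => //; exact: ev_var.
apply: ev_lt; first exact: ev_num.
apply: ev_mul; [|exact: ev_den|].
  by apply: ev_deg => //; exact: ev_var.
by have := sum_bool_leq (fun w => A v w && (memb m z w && ~~ memb m y w)) n;
  rewrite -/(deg m y z v); lia.
Qed.

Lemma ev_dense_card E e1 e2 e3 : E |- e1 ~> m -> E |- e2 ~> y ->
  E |- e3 ~> z -> E |- DenseCard e1 e2 e3 ~> (dense_card m y z).
Proof.
move=> H1 H2 H3; apply: ev_call3 H1 H2 H3 _.
apply: ev_sum; [exact: ev_order|by lia|move=> w a wn].
by apply: ev_dense => //; exact: ev_var.
Qed.

Lemma ev_dense_arcs E e1 e2 e3 : E |- e1 ~> m -> E |- e2 ~> y ->
  E |- e3 ~> z -> E |- DenseArcs e1 e2 e3 ~> (dense_arcs m y z).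
Proof.
move=> H1 H2 H3; apply: ev_call3 H1 H2 H3 _.
apply: ev_sum; [exact: ev_order|by lia|move=> i a1 ni].
apply: ev_sum; [exact: ev_order|by lia|move=> j a2 nj].
apply: ev_and => [|_]; first by apply: ev_adj => //; exact: ev_var.
by apply: ev_and => [|_]; apply: ev_dense => //; exact: ev_var.
Qed.

Lemma dense_arcs_leq : dense_arcs m y z <= n * n.
Proof.
rewrite /dense_arcs big_mkord -[n in X in _ <= X * _]card_ord -sum_nat_const.
by apply: leq_sum => i _; exact: sum_bool_leq.
Qed.

Lemma ev_viol E e1 e2 e3 : E |- e1 ~> m -> E |- e2 ~> y ->
  E |- e3 ~> z -> E |- Viol e1 e2 e3 ~> (viol m y z).
Proof.
move=> H1 H2 H3; apply: ev_call3 H1 H2 H3 _; apply: ev_lt.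
  apply: ev_mul; [|exact: ev_num|].
    by apply: ev_add; apply: ev_dense_card; exact: ev_var.
  by have := sum_bool_leq (dense m y z) n; rewrite /dense_card; lia.
apply: ev_mul; [|exact: ev_den|by have := dense_arcs_leq; lia].
by apply: ev_dense_arcs; exact: ev_var.
Qed.

End Pair.

Lemma ev_good E e1 e2 y : E |- e1 ~> m -> E |- e2 ~> y -> y < codes m ->
  E |- Good e1 e2 ~> (good m y).
Proof.
move=> H1 H2 yc; apply: ev_call2 H1 H2 _; apply: ev_and => [|_].
  apply: ev_le; last exact: ev_budget.
  apply: ev_sum; [exact: ev_order|by lia|move=> w a wn].
  by apply: ev_memb => //; exact: ev_var.
apply: ev_all => //; first by apply: ev_codes => //; exact: ev_var.
by move=> z a zc; apply/ev_not/ev_viol => //; exact: ev_var.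
Qed.

End FixedSize.

(** Once [l] is found, the outer [If] no longer evaluates [Found]; so larger sizes, whose codes
    could be more than [M] in number, are never tried. *)
Lemma ev_ell E l : l <= n -> found l -> (forall m, m < l -> ~~ found m) ->
  (forall m, m <= l -> codes m <= M) -> E |- Ell ~> l.
Proof.
(* [F i] is the accumulator after the sizes below [i] have been tried. *)
move=> ln fl lmin lM; pose F i := if l < i then l.+1 else 0.
have -> : l = F (1 + n) - 1 by rewrite /F add1n ltnS ln subn1.
apply: ev_sub; last exact: ev_const.
apply: (@ev_fold _ _ _ _ _ _ _ _ F); last first.
- move=> i _; have [li|il] := ltnP l i.
    have Fi : F i = l.+1 by rewrite /F li.
    have -> : F i.+1 = F i by rewrite Fi /F ltnS ltnW.
    by apply: (@ev_if_pos _ _ _ _ _ _ _ (F i)); rewrite ?Fi //; exact: ev_var.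
  have Fi : F i = 0 by rewrite /F ltnNge il.
  apply: ev_if_zero; first by rewrite Fi; exact: ev_var.
  rewrite /F ltnS; have [li|li] := leqP l i.
    have -> : i = l by lia.
    apply: (@ev_if_pos _ _ _ _ _ _ _ 1) => //.
      rewrite -[1]/(nat_of_bool true) -fl.
      by apply: ev_found; [| exact: lM | exact: ev_var].
    by rewrite -add1n; apply: ev_add; [exact: ev_const|exact: ev_var].
  apply: ev_if_zero; last exact: ev_const.
  have : [:: i, 0 & E] |- Found (Var 0) ~> (found i).
    by apply: ev_found; [lia | exact: lM | exact: ev_var].
  by rewrite (negPf (lmin _ li)) -/(F i) Fi.
- exact: ev_const.
- by lia.
- by apply: ev_add; [exact: ev_const | exact: ev_order].
Qed.

Lemma ev_solve l : l <= n -> found l -> (forall m, m < l -> ~~ found m) ->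
  (forall m, m <= l -> codes m <= M) -> [::] |- Solve ~> (solve l).
Proof.
move=> ln fl lmin lM; apply: ev_call1; first exact: (@ev_ell [::] l).
apply: ev_ex; [|exact: lM|].
  by apply: ev_codes => //; exact: ev_var.
by move=> y a yc; apply: ev_good => //; [exact: lM|exact: ev_var|exact: ev_var].
Qed.

End Values.

(** * Density and vertex covers *)

Section Graph.
Variables (n : nat) (G : graph 'I_n).
Hypothesis GT : vertices G = [set: 'I_n].

Definition adj (i j : 'I_n) : bool := [set i; j] \in edges G.
Definition arcs (W : {set 'I_n}) : nat := \sum_(i in W) \sum_(j in W) adj i j.
Definition edges_in (W : {set 'I_n}) := [set f in edges G | f \subset W].

Lemma card_edge f : f \in edges G -> #|f| = 2.
Proof.
move=> fG; have /forallP/(_ f)/implyP/(_ fG)/andP[_ /eqP->] := graph_valP G.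
by [].
Qed.

Lemma adjC i j : adj i j = adj j i.
Proof. by rewrite /adj setUC. Qed.

Lemma adjxx i : adj i i = false.
Proof. by apply/negP => /card_edge; rewrite setUid cards1. Qed.

(** The adjacent ordered pairs are partitioned by their underlying edge; the class of an edge {a, b}
    consists of (a, b) and (b, a). *)
Lemma arcs_edges W : arcs W = 2 * #|edges_in W|.
Proof.
have -> : arcs W = #|[set u : 'I_n * 'I_n |
    [&& u.1 \in W, u.2 \in W & adj u.1 u.2]]|.
  rewrite /arcs pair_big /= -sum1_card big_mkcond [RHS]big_mkcond /=.
  apply: eq_bigr => -[i j] _ /=; rewrite inE /=.
  by case: (i \in W); case: (j \in W); case: (adj i j).
rewrite -sum1_card (partition_big (fun u => [set u.1; u.2])
  (fun f => f \in edges_in W)).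
  rewrite mulnC -sum_nat_const; apply: eq_bigr => f.
  rewrite inE => /andP[fG fW]; have /eqP/cards2P[a [b [ab fE]]] := card_edge fG.
  have aW : a \in W by apply: (subsetP fW); rewrite fE !inE eqxx.
  have bW : b \in W by apply: (subsetP fW); rewrite fE !inE eqxx orbT.
  have -> : 2 = #|[set (a, b); (b, a)]|.
    by rewrite cards2 xpair_eqE (negPf ab).
  rewrite -sum1_card; apply: eq_bigl => -[i j]; rewrite !inE /= !xpair_eqE.
  apply/andP/orP => [[/and3P[iW jW ij] /eqP E]|].
    have : i \in [set a; b] by rewrite -fE -E !inE eqxx.
    have : j \in [set a; b] by rewrite -fE -E !inE eqxx orbT.
    have ij' : i != j by apply/eqP => E'; rewrite E' adjxx in ij.
    rewrite !inE => /orP[]/eqP jE /orP[]/eqP iE; subst i j.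
    - by rewrite eqxx in ij'.
    - by right; rewrite !eqxx.
    - by left; rewrite !eqxx.
    - by rewrite eqxx in ij'.
  rewrite /adj => -[]/andP[/eqP-> /eqP->]; rewrite aW bW -?fE ?fG ?eqxx //.
  by rewrite setUC -fE fG eqxx.
move=> [i j]; rewrite !inE /= => /and3P[iW jW ij].
by rewrite [[set i; j] \in _]ij; apply/subsetP => v; rewrite !inE => /orP[]/eqP->.
Qed.

(** The subgraph induced by [W] has density at most [p / q], with denominators cleared and both
    sides doubled, as [arcs] counts every edge twice. *)
Definition sparse (p q : nat) (W : {set 'I_n}) : bool :=
  arcs W * q <= (#|W| + #|W|) * p.

Lemma ratio_leq (e w p q : nat) : 0 < w -> 0 < q ->
  ((e%:R / w%:R : rat) <= p%:R / q%:R)%R = (e * q <= p * w).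
Proof.
move=> w0 q0; rewrite ler_pdivrMr ?ltr0n // mulrAC ler_pdivlMr ?ltr0n //.
by rewrite -!natrM ler_nat.
Qed.

Lemma sparseE p q (W : {set 'I_n}) : 0 < #|W| -> 0 < q ->
  sparse p q W = ((#|edges_in W|%:R / #|W|%:R : rat) <= p%:R / q%:R)%R.
Proof.
move=> W0 q0; rewrite ratio_leq // /sparse arcs_edges addnn -mul2n -!mulnA.
by rewrite leq_pmul2l // [#|W| * p]mulnC.
Qed.

Lemma induced_subproof W : graph_axiom (W, edges_in W).
Proof.
apply/forallP => f; apply/implyP; rewrite inE => /andP[fG /= ->].
by rewrite (card_edge fG).
Qed.

(** Induced subgraphs suffice: a subgraph has at most as many edges as the one induced by its vertex
    set. Empty vertex sets are treated apart, because [sparseE] divides by the cardinal. *)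
Lemma max_density_leq p q (S : {set 'I_n}) : 0 < q ->
  reflect (forall W : {set 'I_n}, [disjoint W & S] -> sparse p q W)
    (max_density (delete_vertices G S) <= p%:R / q%:R)%R.
Proof.
move=> q0; apply: (iffP idP) => [le W dWS|sp].
  have [W0|W0] := posnP #|W|.
    by rewrite /sparse /arcs (cards0_eq W0) big_set0.
  rewrite sparseE //; apply: le_trans le.
  pose H := Graph (induced_subproof W).
  apply: (@le_bigmax_cond _ _ _ 0%R H (fun H => subgraph H (delete_vertices G S))
    (fun H => density H)).
  rewrite /subgraph /vertices /edges /= -/(vertices G) -/(edges G) GT.
  rewrite subsetD subsetT dWS /=; apply/subsetP => f; rewrite !inE.
  by move=> /andP[-> fW]; apply: disjointWl fW dWS.
apply: bigmax_le => [|H /andP[HV HE]].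
  by rewrite divr_ge0 ?ler0n.
have [W0|W0] := posnP #|vertices H|.
  by rewrite /density W0 invr0 mulr0 divr_ge0 ?ler0n.
have := sp (vertices H); rewrite sparseE // => spH.
apply: le_trans (spH _); last first.
  by move: HV; rewrite /= {2}/vertices /= subsetD => /andP[].
rewrite /density ler_wpM2r ?invr_ge0 ?ler0n // ler_nat subset_leq_card //.
apply/subsetP => f fH; move/subsetP/(_ f fH): HE; rewrite !inE => /andP[-> _].
by have /forallP/(_ f)/implyP/(_ fH)/andP[] := graph_valP H.
Qed.

Lemma bdvd_iff k (tau : rat) : (0 <= tau)%R ->
  reflect (exists2 S : {set 'I_n}, #|S| <= k &
      forall W : {set 'I_n}, [disjoint W & S] -> sparse `|numq tau| `|denq tau| W)
    (bounded_density_vertex_deletion G k tau).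
Proof.
move=> tau0.
have tauE : tau = (`|numq tau|%N%:R / `|denq tau|%N%:R)%R.
  by rewrite -{1}[tau]divq_num_den !pmulrn !gez0_abs ?numq_ge0 ?denq_ge0.
have q0 : 0 < `|denq tau| by rewrite absz_gt0 denq_neq0.
apply: (iffP existsP) => [[S /and3P[_ Sk]]|[S Sk sp]].
  by rewrite {1}tauE => /(max_density_leq _ _ q0); exists S.
exists S; rewrite Sk GT subsetT /= {1}tauE.
exact/(max_density_leq _ _ q0).
Qed.

Definition nbrs (D : {set 'I_n}) (v : 'I_n) : nat := \sum_(w in D) adj v w.

(** The mixed term is doubled because an adjacency between the two parts gives one arc in either
    direction. *)
Lemma arcsU (D X : {set 'I_n}) : [disjoint D & X] ->
  arcs (D :|: X) = arcs D + (\sum_(v in X) nbrs D v).*2 + arcs X.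
Proof.
move=> dDX; have big_U F : \sum_(i in D :|: X) F i =
    \sum_(i in D) F i + \sum_(i in X) F i :> nat.
  by rewrite -bigU //=; apply: eq_bigl => i; rewrite inE.
rewrite /arcs big_U.
have -> : \sum_(i in D) \sum_(j in D :|: X) adj i j =
    arcs D + \sum_(v in X) nbrs D v.
  under eq_bigr do rewrite big_U.
  rewrite big_split /=; congr (_ + _); rewrite exchange_big /=.
  by apply: eq_bigr => j _; apply: eq_bigr => i _; rewrite adjC.
have -> : \sum_(i in X) \sum_(j in D :|: X) adj i j =
    \sum_(v in X) nbrs D v + arcs X.
  by under eq_bigr do rewrite big_U; rewrite big_split.
by rewrite -addnn !addnA.
Qed.

Lemma cover_adj C i j : vertex_cover G C -> adj i j -> (i \in C) || (j \in C).
Proof.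
move=> /andP[_ /forallP/(_ [set i; j])/implyP/[apply]].
rewrite disjoint_sym; apply: contraR; rewrite negb_or => /andP[iC jC].
rewrite disjoints_subset; apply/subsetP => v vC; rewrite !inE.
by apply/norP; split; apply: contraTneq vC => ->.
Qed.

Lemma coverI (C : {set 'I_n}) :
  (forall i j, adj i j -> (i \in C) || (j \in C)) -> vertex_cover G C.
Proof.
move=> H; rewrite /vertex_cover GT subsetT /=.
apply/forallP => f; apply/implyP => fG.
have /eqP/cards2P[a [b [_ fE]]] := card_edge fG; rewrite fE in fG *.
apply/negP; rewrite disjoints_subset => /subsetP sf.
by case/orP: (H _ _ fG) => h; [have := sf a|have := sf b];
  rewrite !inE eqxx ?orbT h => /(_ isT).
Qed.

Lemma arcs_indep (C X : {set 'I_n}) :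
  vertex_cover G C -> [disjoint X & C] -> arcs X = 0.
Proof.
move=> cC dXC; apply: big1 => i iX; apply: big1 => j jX.
case ij: (adj i j) => //; have := cover_adj cC ij.
by rewrite !(disjointFr dXC).
Qed.

(* Given the trace [D] of a dense set on the cover, the densest extension adds
   exactly the vertices with more than [p / q] neighbours in [D]. *)
Definition extension p q (S D : {set 'I_n}) : {set 'I_n} :=
  [set v | (v \notin S) && ((v \in D) || (p < nbrs (D :\: S) v * q))].

(** Outside the trace [D], the set [W] is independent, so each such vertex [v] changes the balance
    of edges against vertices by [nbrs D v * q - p] only. The extension collects all positive
    changes available outside [S], and arcs among the added vertices only increase its density. *)
Lemma sparse_extension p q (S C W : {set 'I_n}) : vertex_cover G C ->
  [disjoint W & S] -> sparse p q (extension p q S (W :&: C)) -> sparse p q W.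
Proof.
move=> cC dWS; set U := extension _ _ _ _; set D := W :&: C.
have DS : D :\: S = D.
  by apply/setDidPl; apply: disjointWl dWS; exact: subsetIl.
have DU : D \subset U.
  apply/subsetP => v vD; rewrite inE vD /= andbT.
  by move: vD; rewrite inE => /andP[vW _]; rewrite (disjointFr dWS vW).
have WE : W = D :|: W :\: D.
  by rewrite -{1}(setID W D) (setIidPr (subsetIl W C)).
have UE : U = D :|: U :\: D by rewrite -{1}(setID U D) (setIidPr DU).
have dD (X : {set 'I_n}) : [disjoint D & X :\: D].
  by rewrite disjoints_subset; apply/subsetP => v vD; rewrite in_setC in_setD vD.
have arcsX : arcs (W :\: D) = 0.
  apply: (arcs_indep cC); rewrite disjoints_subset; apply/subsetP => v.
  by rewrite !inE => /andP[/nandP[/negPf->|//] ].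
(* The total change over [W :\: D] is at most that over [U :\: D], written without subtraction and
   compared vertex by vertex. *)
have key : (\sum_(v in W :\: D) nbrs D v) * q + #|U :\: D| * p <=
    (\sum_(v in U :\: D) nbrs D v) * q + #|W :\: D| * p.
  rewrite -!sum1_card !big_distrl /=.
  rewrite !(big_mkcond (fun v => v \in _)) -!big_split /=.
  apply: leq_sum => v _; rewrite !mul1n !in_setD.
  have -> : (v \in U) = (v \notin S) && ((v \in D) || (p < nbrs D v * q)).
    by rewrite inE DS.
  case vD: (v \in D) => //=.
  case vW: (v \in W) => /=.
    rewrite (disjointFr dWS vW) /=.
    by case: ltnP => ?; lia.
  by case: (v \in S) => //=; case: ltnP => //; lia.
rewrite /sparse UE [in X in _ -> X]WE !arcsU // arcsX.
rewrite !cardsU !(disjoint_setI0 (dD _)) cards0 !subn0.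
move: key; move: (\sum_(v in W :\: D) _) (\sum_(v in U :\: D) _) => a b key.
rewrite -!mul2n !mulnDl; move: (arcs (U :\: D)) => c.
have : 2 * a * q = 2 * (a * q) by lia.
have : 2 * b * q = 2 * (b * q) by lia.
by lia.
Qed.

End Graph.

(** * Codes and correctness *)

(** Induction from the least significant digit: the shifted digit sequence is coded first, then
    multiplied by [b]. *)
Lemma exists_digits b m (d : nat -> nat) : (forall j, d j < b) ->
  exists2 x, x < b ^ m & forall j, j < m -> digit b x j = d j.
Proof.
elim: m d => [|m IHm] d db; first by exists 0.
have [x xb xd] := IHm (fun j => d j.+1) (fun j => db j.+1).
have b0 : 0 < b by apply: leq_ltn_trans (db 0).
exists (d 0 + x * b).
  have : x.+1 * b <= b ^ m * b by rewrite leq_mul2r xb orbT.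
  by have := db 0; rewrite mulSn -expnSr; lia.
case=> [_|j jm]; first by rewrite /digit divn1 addnC modnMDl modn_small.
rewrite -(xd j) // /digit expnS divnMA addnC divnMDl // (divn_small (db 0)).
by rewrite addn0.
Qed.

Section Codes.
Variables (n : nat) (A : nat -> nat -> bool).

Definition decode m x : {set 'I_n} := [set v : 'I_n | memb n A m x v].
Definition cands m : {set 'I_n} := [set v : 'I_n | cand n A m v].

Lemma sum_bool_card (P : nat -> bool) r : r <= n ->
  \sum_(0 <= w < r) P w = #|[set w : 'I_n | (w < r) && P w]|.
Proof.
move=> rn; rewrite big_mkord (big_ord_widen n (fun w => nat_of_bool (P w)) rn).
rewrite -sum1_card.
rewrite big_mkcond [RHS]big_mkcond /=; apply: eq_bigr => i _.
by rewrite inE; case: ltnP => //= _; case: (P i).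
Qed.

Lemma sum_bool_cardT (P : nat -> bool) :
  \sum_(0 <= w < n) P w = #|[set w : 'I_n | P w]|.
Proof.
by rewrite sum_bool_card //; apply: eq_card => w; rewrite !inE ltn_ord.
Qed.

(** The earlier twins of [v] together with [v] itself form a subset of [X], so they number less than
    [#|X|]. *)
Lemma cand_closed (X : {set 'I_n}) m (v : 'I_n) : v \in X ->
  (forall w : 'I_n, w < v -> twin n A w v -> w \in X) -> #|X| <= m ->
  cand n A m v.
Proof.
move=> vX Xv Xm; rewrite /cand sum_bool_card; last exact: ltnW.
set Y := [set w | _]; apply: leq_trans Xm.
have -> : #|Y|.+1 = #|v |: Y| by rewrite cardsU1 inE ltnn.
apply: subset_leq_card; rewrite subUset sub1set vX /=.
by apply/subsetP => w; rewrite inE => /andP[]; exact: Xv.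
Qed.

Lemma rank_ltn m u v : cand n A m u -> u < v -> rank n A m u < rank n A m v.
Proof.
move=> cu uv; rewrite /rank (@big_cat_nat _ _ _ u.+1 0 v) //=.
by rewrite big_nat_recr //= cu; lia.
Qed.

Lemma rank_inj m u v : cand n A m u -> cand n A m v ->
  rank n A m u = rank n A m v -> u = v.
Proof.
move=> cu cv E; case: (ltngtP u v) => // uv.
  by have := rank_ltn cu uv; rewrite E ltnn.
by have := rank_ltn cv uv; rewrite E ltnn.
Qed.

(** Ranks are injective on candidates, so each of the [m] digits names at most one vertex. *)
Lemma card_decode m x : #|decode m x| <= m.
Proof.
pose g (j : 'I_m) := [pick v : 'I_n | cand n A m v &&
  (digit (base n A m) x j == 1 + rank n A m v)].
rewrite -(card_imset _ (@Some_inj _)).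
apply: (@leq_trans #|image g 'I_m|); last first.
  by rewrite -[X in _ <= X]card_ord leq_image_card.
apply: subset_leq_card; apply/subsetP => _ /imsetP[v + ->].
rewrite inE => /andP[cv /hasP[j]]; rewrite mem_iota add0n => /= jm Hj.
apply/imageP; exists (Ordinal jm) => //; rewrite /g.
case: pickP => [u /andP[cu /eqP Hu]|/(_ v)]; last by rewrite cv Hj.
congr Some; apply/val_inj/(rank_inj cv cu).
by move/eqP: Hj; rewrite Hu; lia.
Qed.

Lemma decode_onto m (D : {set 'I_n}) : D \subset cands m -> #|D| <= m ->
  exists2 x, x < codes n A m & decode m x = D.
Proof.
move=> sD cD.
(* The default 0 pads the code with the digit that names no vertex. *)
pose d j := nth 0 [seq 1 + rank n A m (v : 'I_n) | v <- enum D] j.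
have db j : d j < base n A m.
  rewrite /d; case: (ltnP j (size (enum D))) => jD; last first.
    by rewrite nth_default ?size_map.
  have [v0 _] : exists v, v \in D.
    case: (enum D) (mem_enum D) jD => // v s vs _.
    by exists v; rewrite -vs inE eqxx.
  rewrite (nth_map v0) // /base ltn_add2l; apply: rank_ltn => //.
  have : nth v0 (enum D) j \in D by rewrite -mem_enum mem_nth.
  by move/(subsetP sD); rewrite inE.
have [x xb xd] := @exists_digits (base n A m) m d db.
exists x => //; apply/setP => v; rewrite inE /memb.
apply/andP/idP => [[cv /hasP[j]]|vD].
  rewrite mem_iota add0n => /= jm; rewrite xd // => /eqP dj.
  have jD : j < size (enum D).
    by rewrite ltnNge; apply/negP => le; move: dj; rewrite /d nth_default ?size_map.
  move: dj; rewrite /d (nth_map v) // => dj.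
  have uD : nth v (enum D) j \in D by rewrite -mem_enum mem_nth.
  have := subsetP sD _ uD; rewrite inE => cu.
  by rewrite -(val_inj (rank_inj cu cv _)) //; lia.
have := subsetP sD _ vD; rewrite inE => cv; split=> //.
have jD : index v (enum D) < size (enum D) by rewrite index_mem mem_enum.
have jm : index v (enum D) < m by apply: leq_trans jD _; rewrite -cardE.
apply/hasP; exists (index v (enum D)); first by rewrite mem_iota.
by rewrite xd // /d (nth_map v) // nth_index // mem_enum.
Qed.

Lemma base_cands m : base n A m = #|cands m|.+1.
Proof. by rewrite /base /rank sum_bool_cardT add1n. Qed.

End Codes.

(** * Twins, minimum covers and correctness of the search *)

Section Correctness.
Variables (n : nat) (G : graph 'I_n) (A : nat -> nat -> bool).
Hypothesis GT : vertices G = [set: 'I_n].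
Hypothesis AE : forall i j : 'I_n, A i j = adj G i j.
Local Notation l := (vertex_cover_number G).

Lemma twinP (u v : 'I_n) :
  reflect (forall w, adj G u w = adj G v w) (twin n A u v).
Proof.
apply: (iffP allP) => [H w|H w].
  have := H w; rewrite mem_iota ltn_ord !AE => /(_ isT).
  by case: (adj G u w); case: (adj G v w).
by rewrite mem_iota add0n => /= wn; have := H (Ordinal wn); rewrite -!AE => ->.
Qed.

Lemma min_cover : exists C, [/\ vertex_cover G C, #|C| = l
  & forall C', vertex_cover G C' -> l <= #|C'|].
Proof.
rewrite /vertex_cover_number; case: arg_minnP => [|C cC minC].
  by apply: (coverI GT) => i j _; rewrite GT inE.
by exists C.
Qed.

(** A minimum cover is closed under twins: if a twin [w] of [v] in [C] were outside [C], all
    neighbours of [w], which are those of [v], would lie in [C], and [C :\ v] would be a smaller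
    cover. *)
Lemma min_cover_cands C : vertex_cover G C -> #|C| = l ->
  (forall C', vertex_cover G C' -> l <= #|C'|) -> C \subset cands n A l.
Proof.
move=> cC Cl minC; apply/subsetP => v vC; rewrite inE.
apply: (cand_closed vC); last by rewrite Cl.
move=> w _ /twinP tw; apply/negPn/negP => wC.
suff /minC : vertex_cover G (C :\ v) by rewrite -Cl (cardsD1 v C) vC; lia.
have nbv j : adj G v j -> j \in C :\ v.
  move=> vj; rewrite !inE; apply/andP; split.
    by apply/eqP => E; rewrite E adjxx in vj.
  by have := cover_adj cC (_ : adj G w j); rewrite tw vj (negPf wC); apply.
apply: (coverI GT) => i j ij.
have [E|iv] := eqVneq i v; first by rewrite (nbv j) ?orbT // -E.
have [E|jv] := eqVneq j v; first by rewrite (nbv i) // -E adjC.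
by rewrite !inE iv jv; exact: cover_adj ij.
Qed.

Lemma adj_tperm (u v i j : 'I_n) : twin n A u v ->
  adj G (tperm u v i) (tperm u v j) = adj G i j.
Proof.
move=> /twinP tw; have tw1 i' j' : adj G (tperm u v i') j' = adj G i' j'.
  by case: tpermP => [->|->|] //; rewrite tw.
by rewrite tw1 adjC tw1 adjC.
Qed.

Lemma sparse_tperm p q (u v : 'I_n) (W : {set 'I_n}) : twin n A u v ->
  sparse G p q (tperm u v @: W) = sparse G p q W.
Proof.
move=> tw; rewrite /sparse card_imset; last exact: perm_inj.
have inj (X : {set 'I_n}) : {in X &, injective (tperm u v)}.
  by move=> ? ? _ _; exact: perm_inj.
congr (_ * _ <= _); rewrite /arcs big_imset //=.
apply: eq_bigr => i _; rewrite big_imset //=.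
by apply: eq_bigr => j _; rewrite adj_tperm.
Qed.

(* Swapping twins is an automorphism, so among the solutions of a given size
   one with least index sum contains, with a vertex, all its earlier twins. *)
Lemma solution_cands p q (S : {set 'I_n}) :
  (forall W : {set 'I_n}, [disjoint W & S] -> sparse G p q W) ->
  exists S' : {set 'I_n}, [/\ #|S'| = #|S|, S' \subset cands n A #|S|
    & forall W : {set 'I_n}, [disjoint W & S'] -> sparse G p q W].
Proof.
have [N] := ubnP (\sum_(v in S) (v : nat)).
elim: N S => // N IHN S SN sp.
have [sS|] := boolP (S \subset cands n A #|S|); first by exists S.
case/subsetPn => v vS; rewrite inE => ncv.
have [w /and3P[wv tw wS]] :
    exists w : 'I_n, [&& w < v, twin n A w v & w \notin S].
  apply/existsP; apply: contraR ncv; rewrite negb_exists => /forallP H.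
  apply: (cand_closed vS) => // w wv tw.
  by have := H w; rewrite wv tw /= negbK.
have wNv : w != v by apply/eqP => E; rewrite E ltnn in wv.
pose S1 := w |: S :\ v.
have wSv : w \notin S :\ v by rewrite inE (negPf wS) andbF.
have cS1 : #|S1| = #|S| by rewrite cardsU1 wSv (cardsD1 v S) vS.
have [||S' [cS' sS' spS']] := IHN S1.
- move: SN; rewrite (big_setD1 v) //= big_setU1 //=.
  by move: (\sum_(i in S :\ v) _) => X; lia.
(* Swapping [v] and [w] carries a set disjoint from [S1] to one disjoint from [S]. *)
- move=> W dW; rewrite -(sparse_tperm p q W tw); apply: sp.
  rewrite disjoint_sym disjoints_subset; apply/subsetP => z zS; rewrite inE.
  apply/negP => /imsetP[y yW zE].
  have := disjointFr dW yW; rewrite !inE => /norP[yw].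
  move: zE; case: tpermP yw => [->|-> _ zw|]; rewrite ?eqxx //.
    by move: wS; rewrite -zw zS.
  by move=> _ /eqP yv yw zy; rewrite yv -zy zS.
by exists S'; rewrite -cS1.
Qed.

Lemma coverb_cover m x : coverb n A m x = vertex_cover G (decode n A m x).
Proof.
apply/allP/idP => [H|H i].
  apply: (coverI GT) => i j ij; rewrite !inE.
  have := H i; rewrite mem_iota ltn_ord => /(_ isT)/allP/(_ j).
  by rewrite mem_iota ltn_ord AE ij => /(_ isT).
rewrite mem_iota add0n => /= ni; apply/allP => j.
rewrite mem_iota add0n => /= nj.
have := @cover_adj _ G _ (Ordinal ni) (Ordinal nj) H.
by rewrite -AE /= !inE /=; case: (A i j) => //= /(_ isT).
Qed.

(** A code for size [m] decodes to at most [m] vertices. Together with [found_min], the least size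
    found is the vertex cover number. *)
Lemma found_leq m : found n A m -> l <= m.
Proof.
have [C [_ _ minC]] := min_cover.
move=> /hasP[x _]; rewrite coverb_cover => /minC le.
by apply: leq_trans le _; exact: card_decode.
Qed.

Lemma found_min : found n A l.
Proof.
have [C [cC Cl minC]] := min_cover.
have [|x xc xC] := decode_onto (min_cover_cands cC Cl minC).
  by rewrite Cl.
by apply/hasP; exists x; rewrite ?mem_iota // coverb_cover xC.
Qed.

Lemma cover_number_leq : l <= n.
Proof.
have [C [_ <- _]] := min_cover.
by rewrite -[n in X in _ <= X]card_ord max_card.
Qed.

Lemma dense_extension p q m x y (v : 'I_n) :
  dense n p q A m x y v =
  (v \in extension G p q (decode n A m x) (decode n A m y)).
Proof.
rewrite !inE /dense; congr (_ && (_ || _)).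
congr (_ < _ * _); rewrite /deg big_mkord /nbrs [RHS]big_mkcond /=.
apply: eq_bigr => w _; rewrite AE !inE.
by case: (adj G v w); case: (memb _ _ _ y w); case: (memb _ _ _ x w).
Qed.

Lemma viol_extension p q m x y : viol n p q A m x y =
  ~~ sparse G p q (extension G p q (decode n A m x) (decode n A m y)).
Proof.
rewrite /viol /sparse -ltnNge; set U := extension _ _ _ _ _.
have -> : dense_card n p q A m x y = #|U|.
  rewrite /dense_card sum_bool_cardT; apply: eq_card => v.
  by rewrite inE dense_extension.
congr (_ < _ * _); rewrite /dense_arcs big_mkord /arcs [RHS]big_mkcond /=.
apply: eq_bigr => i _; rewrite big_mkord dense_extension -/U.
case: (i \in U); last by apply: big1 => j _; rewrite andbF.
rewrite [RHS]big_mkcond /=; apply: eq_bigr => j _.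
by rewrite dense_extension AE -/U; case: (j \in U); case: (adj G i j).
Qed.

Lemma solve_correct k (tau : rat) : (0 <= tau)%R ->
  solve n k `|numq tau| `|denq tau| A l =
  bounded_density_vertex_deletion G k tau.
Proof.
move=> tau0; set p := `|numq tau|%N; set q := `|denq tau|%N.
have [C [cC Cl minC]] := min_cover.
have sC := min_cover_cands cC Cl minC.
apply/idP/(bdvd_iff GT _ tau0); rewrite -/p -/q.
  move=> /hasP[x _ /andP[xk /allP nv]]; exists (decode n A l x).
    by move: xk; rewrite sum_bool_cardT.
  move=> W dW; apply: (sparse_extension cC dW).
  (* The trace of [W] lies in a minimum cover of candidates, so it is among the sets tried. *)
  have [||y yc <-] := @decode_onto n A l (W :&: C).
  - by apply: subset_trans sC; exact: subsetIr.
  - by rewrite -Cl subset_leq_card // subsetIr.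
  by have := nv y; rewrite mem_iota yc viol_extension negbK => /(_ isT).
move=> [S Sk sp].
suff [S' [S'k S'l S'c sp']] : exists S' : {set 'I_n},
    [/\ #|S'| <= k, #|S'| <= l, S' \subset cands n A l
    & forall W : {set 'I_n}, [disjoint W & S'] -> sparse G p q W].
  have [x xc xS] := decode_onto S'c S'l.
  apply/hasP; exists x; first by rewrite mem_iota.
  rewrite /good sum_bool_cardT -/(decode n A l x) xS S'k /=.
  (* Every extension avoids the deletion set, so it is sparse by the choice of that set. *)
  apply/allP => y _; rewrite viol_extension negbK xS; apply: sp'.
  rewrite disjoints_subset; apply/subsetP => v.
  by rewrite !inE => /andP[].
(* If the budget allows it, a minimum cover is itself a solution, since no edge survives. *)
have [lk|kl] := leqP l k.
  exists C; rewrite Cl; split=> // W dW.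
  by rewrite /sparse (arcs_indep cC dW).
have [S' [cS' sS' sp']] := solution_cands sp.
have Sl : #|S| <= l by apply: leq_trans Sk (ltnW kl).
exists S'; rewrite cS'; split=> //; apply: subset_trans sS' _.
by apply/subsetP => v; rewrite !inE => /leq_trans; apply.
Qed.

(** A candidate is determined by its number of earlier twins, which is less than [m], and its
    neighbourhood. The latter is a subset of the cover for a vertex outside it, and one of at most
    [l] sets for a vertex inside it. *)
Lemma card_cands m : #|cands n A m| <= m * (2 ^ l + l).
Proof.
have [C [cC Cl _]] := min_cover.
case: m => [|m].
  rewrite mul0n leqn0 cards_eq0; apply/eqP/setP => v; rewrite !inE.
  by rewrite /cand ltn0.
pose N v := [set w | adj G v w].
pose NC := powerset C :|: N @: C.
pose t (v : 'I_n) := \sum_(0 <= w < v) twin n A w v.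
pose f v := (inord (t v) : 'I_m.+1, N v).
have t_mono (u v : 'I_n) : twin n A u v -> u < v -> t u < t v.
  move=> tw uv; rewrite /t [X in _ < X](@big_cat_nat _ _ _ u.+1) //=.
  rewrite big_nat_recr //= tw.
  (* Being twins is an equivalence relation, so [u] and [v] have the same twins below [u]. *)
  suff -> : \sum_(0 <= i < u) twin n A i v = t u
    by rewrite -/(t u) addn1 addSn ltnS leq_addr.
  apply: eq_big_nat => i /andP[_ iu].
  have ni : i < n by apply: ltn_trans iu (ltn_ord u).
  congr nat_of_bool; apply/(twinP (Ordinal ni))/(twinP (Ordinal ni)) => H w.
    by rewrite H; apply/esym; move/twinP: tw.
  by rewrite H; move/twinP: tw.
have finj : {in cands n A m.+1 &, injective f}.
  move=> u v; rewrite !inE => cu cv [] tE NE.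
  have tw (a b : 'I_n) : N a = N b -> twin n A a b.
    move=> E; apply/twinP => w; have : (w \in N a) = (w \in N b) by rewrite E.
    by rewrite !inE.
  have tE' : t u = t v.
    by move/(congr1 val): tE; rewrite /= !inordK.
  apply/val_inj; case: (ltngtP u v) => // uv.
    by have := t_mono _ _ (tw _ _ NE) uv; rewrite tE' ltnn.
  by have := t_mono _ _ (tw _ _ (esym NE)) uv; rewrite tE' ltnn.
rewrite -(card_in_imset finj).
apply: (@leq_trans #|setX [set: 'I_m.+1] NC|).
  apply: subset_leq_card; apply/subsetP => _ /imsetP[v vc ->].
  rewrite in_setX in_setT in_setU /=; have [vC|vC] := boolP (v \in C).
    by rewrite imset_f ?orbT.
  rewrite powersetE; apply/orP; left; apply/subsetP => w; rewrite inE.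
  by move/(cover_adj cC); rewrite (negPf vC).
rewrite cardsX cardsT card_ord leq_mul2l /=.
apply: leq_trans (leq_card_setU _ _) _.
by rewrite card_powerset Cl leq_add2l -Cl leq_imset_card.
Qed.

(** The base is at most 1 + l (2^l + l) <= 1 + 2 * 4^l <= 2^(2l + 2), and (2l + 2) l <= 4 l^2. *)
Lemma codes_leq m : m <= l -> codes n A m <= 2 ^ (4 * l ^ 2).
Proof.
move=> ml; have bE : base n A m <= 2 ^ (2 * l + 2).
  rewrite base_cands; have := card_cands m.
  have l2 : l < 2 ^ l by exact: ltn_expl.
  have : m * (2 ^ l + l) <= 2 ^ l * (2 ^ l + 2 ^ l).
    by apply: leq_mul; lia.
  have -> : 2 ^ (2 * l + 2) = 4 * (2 ^ l * 2 ^ l).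
    by rewrite expnD mul2n -addnn expnD mulnC.
  have : 0 < 2 ^ l * 2 ^ l by rewrite muln_gt0; lia.
  by rewrite mulnDr; lia.
apply: (@leq_trans ((2 ^ (2 * l + 2)) ^ l)).
  have [l0|m0] := posnP m; first by rewrite /codes l0 expn0 expn_gt0 expn_gt0.
  apply: (@leq_trans ((2 ^ (2 * l + 2)) ^ m)); first by rewrite leq_exp2r.
  by rewrite leq_pexp2l // expn_gt0.
by rewrite -expnM leq_pexp2l // -mulnn; nia.
Qed.

End Correctness.

Lemma nth_allpairs_index (R S T : Type) (f : R -> S -> T) z0 x0 y0 s t i j :
  i < size s -> j < size t ->
  nth z0 [seq f x y | x <- s, y <- t] (i * size t + j) =
  f (nth x0 s i) (nth y0 t j).
Proof.
elim: s i => // x s IHs [|i] is_ jt; rewrite /= nth_cat size_map.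
  by rewrite mul0n add0n jt (nth_map y0).
by rewrite mulSn -addnA ltnNge leq_addr /= addKn IHs.
Qed.

Theorem theorem20 :
  exists (P : program) (a b d : nat),
    forall (n : nat) (G : graph 'I_n) (k : nat) (tau : rat),
      vertices G = [set: 'I_n] ->
      (0 <= tau)%R ->
      outputs_within P (encode G k tau)
        (bounded_density_vertex_deletion G k tau)
        (a * 2 ^ (b * vertex_cover_number G ^ 2) * n.+1 ^ d).
Proof.
have [P [c [d HP]]] := ram_of_exp Solve.
(* The exponents are those obtained by expanding [M ^ d] for the loop bound [M] chosen below. *)
exists P, c, (4 * d), (2 * d) => n G k tau GT tau0.
set l := vertex_cover_number G; set x := encode G k tau.
(* Adjacency is read off the input so as to be defined on all numbers; it agrees with the graph on
   indices below [n]. *)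
pose A i j := nth 0 x (4 + (i * n + j)) == 1.
have nthx (i j : 'I_n) : nth 0 x (4 + (i * n + j)) = adj G i j.
  have := nth_allpairs_index (fun i j => nat_of_bool (adj G i j)) 0 i j
    (s := enum 'I_n) (t := enum 'I_n) (i := i) (j := j).
  by rewrite size_enum_ord !nth_ord_enum; apply.
have AE (i j : 'I_n) : A i j = adj G i j by rewrite /A nthx; case: adj.
pose M := n.+1 ^ 2 * 2 ^ (4 * l ^ 2).
have pow0 : 0 < 2 ^ (4 * l ^ 2) by rewrite expn_gt0.
have -> : c * 2 ^ (4 * d * l ^ 2) * n.+1 ^ (2 * d) = c * M ^ d.
  by rewrite /M expnMn -!expnM -mulnA [X in _ * X]mulnC [4 * d * _]mulnAC.
have nM : n * n + n + n + 1 <= M.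
  by rewrite /M -mulnn; apply: leq_trans (leq_pmulr _ pow0); lia.
have cM m : m <= l -> codes n A m <= M.
  by move/(codes_leq GT AE)/leq_trans; apply; rewrite leq_pmull // expn_gt0.
apply: HP; [|by lia|by lia|].
  rewrite /= size_allpairs size_enum_ord; lia.
rewrite -(solve_correct GT AE _ tau0).
apply: (@ev_solve n k `|numq tau| `|denq tau| A M x) => //.
- move=> i j ni nj; rewrite (nthx (Ordinal ni) (Ordinal nj)).
  by rewrite -AE.
- exact: cover_number_leq.
- exact: found_min.
- by move=> m ml; apply: contraL ml => /(found_leq GT AE); rewrite -leqNgt.
Qed.
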